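(* Let $Q_1,Q_2$ be two non-empty finite posets, and let $n\ge 1$ be an integer. (a) If $r\ge 2$, then $$La(n,P_{l(Q_1)+l(Q_2)+2},Q_1\otimes_rQ_2)\le n^{2r+2}\max_{0\le i<j\le n}\left\{\binom{n}{j}\binom{j}{i}\,\gamma^r_{0,j-i}\left(\binom{[j-i]}{\lfloor (j-i)/2\rfloor}\right)La(i,P_{l(Q_1)+1},Q_1)\,La(n-j,P_{l(Q_2)+1},Q_2)\right\}.$$ Furthermore, if $r\ge 3$ and the level conjecture almost holds for the pairs $P_{l(Q_1)+1},Q_1$ and $P_{l(Q_2)+1},Q_2$, then it almost holds for the pair $P_{l(Q_1\otimes_rQ_2)+1},\,Q_1\otimes_rQ_2$. (b) If $r=1$, then $$La(n,P_{l(Q_1)+l(Q_2)+2},Q_1\otimes_1Q_2)\le\max_{0\le j\le n}\left\{\binom{n}{j}La(j,P_{l(Q_1)+1},Q_1)\,La(n-j,P_{l(Q_2)+1},Q_2)\right\}.$$ Furthermore, if the level conjecture strongly holds for the pairs $P_{l(Q_1)+1},Q_1$ and $P_{l(Q_2)+1},Q_2$, then it strongly holds for the pair $P_{l(Q_1\otimes_1Q_2)+1},\,Q_1\otimes_1Q_2$; and the same is true with ''strongly holds'' replaced by ''almost holds'' throughout.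
   Context: $[n]=\{1,\dots,n\}$ (with $[0]=\emptyset$), $2^{[n]}$ is the family of all subsets of $[n]$, and, for a set $X$, $\binom{X}{k}$ denotes the family of all $k$-element subsets of $X$; the families $\binom{[n]}{k}$ are the full levels of $2^{[n]}$. For a finite poset $P$ and a family $\mathcal{F}$ of sets, a subfamily $\mathcal{G}\subseteq\mathcal{F}$ is a copy of $P$ in $\mathcal{F}$ if there is a bijection $\phi:P\to\mathcal{G}$ such that $x\le_Px'$ implies $\phi(x)\subseteq\phi(x')$ (the converse is not required). $c(P,\mathcal{F})$ is the number of copies of $P$ in $\mathcal{F}$; $\mathcal{F}$ is $P$-free if $c(P,\mathcal{F})=0$. $La(n,P,Q)=\max\{c(Q,\mathcal{F}):\mathcal{F}\subseteq 2^{[n]},\ c(P,\mathcal{F})=0\}$. $P_k$ is the chain on $k$ elements, and $l(P)$ is the height of $P$ (number of elements in a longest chain of $P$). For posets $Q_1,Q_2$ and $r\ge 1$, $Q_1\otimes_rQ_2$ is the poset on the disjoint union of $Q_1$, $Q_2$ and $r$ new elements $m_1,\dots,m_r$, where the order restricted to $Q_1$ and to $Q_2$ is the original one, $q<m_k<q'$ for all $q\in Q_1$, $q'\in Q_2$ and all $k$ (hence also $q<q'$), and $m_1,\dots,m_r$ form an antichain. Note $l(Q_1\otimes_rQ_2)=l(Q_1)+l(Q_2)+1$. For $\mathcal{F}\subseteq 2^{[m]}$, $\gamma^r_{0,m}(\mathcal{F})$ is the number of unordered $r$-tuples $\{F_1,\dots,F_r\}$ of $r$ different members of $\mathcal{F}$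 with $F_1\cap\dots\cap F_r=\emptyset$ and $F_1\cup\dots\cup F_r=[m]$. For a pair $P,Q$ of posets we say that the level conjecture strongly holds if for all sufficiently large $n$ there is a $P$-free family $\mathcal{F}_n\subseteq 2^{[n]}$ that is a union of full levels of $2^{[n]}$ with $La(n,P,Q)=c(Q,\mathcal{F}_n)$; it almost holds if there is a sequence of $P$-free families $\mathcal{F}_n\subseteq 2^{[n]}$, each a union of full levels of $2^{[n]}$, with $La(n,P,Q)=O(n^kc(Q,\mathcal{F}_n))$ for some $k$ depending only on $P$ and $Q$. *)

(* Defs.v *)
From HB Require Import structures.
From mathcomp Require Import all_boot all_order.

Set Implicit Arguments.
Unset Strict Implicit.
Unset Printing Implicit Defensive.

(* The ground set [n] is encoded as 'I_n = {0, ..., n-1}; families of subsets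
   of [n] are terms of type {set {set 'I_n}}. *)

Section Copies.

Variables (d : Order.disp_t) (P : finPOrderType d) (T : finType).
Implicit Types F G : {set {set T}}.

(* Weak copies: phi is only required to preserve the order of P. *)
Definition is_copy G : bool :=
  [exists phi : {ffun P -> {set T}},
    [&& injectiveb phi, [set phi x | x : P] == G &
        [forall x : P, forall y : P, (x <= y)%O ==> (phi x \subset phi y)]]].

Definition copies F : nat :=
  #|[set G : {set {set T}} | (G \subset F) && is_copy G]|.

Definition poset_free F : bool := copies F == 0.

End Copies.

Definition La (n : nat) (dP dQ : Order.disp_t)
    (P : finPOrderType dP) (Q : finPOrderType dQ) : nat :=
  \max_(F : {set {set 'I_n}} | poset_free P F) copies Q F.

Definition chain_poset (k : nat) : finPOrderType _ := 'I_k.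

Definition is_chain (d : Order.disp_t) (P : finPOrderType d) (A : {set P}) :
    bool :=
  [forall x in A, forall y in A, (x >=< y)%O].

Definition height (d : Order.disp_t) (P : finPOrderType d) : nat :=
  \max_(A : {set P} | is_chain A) #|A|.

Fact otimes_display (d1 d2 : Order.disp_t) : Order.disp_t.
Proof. exact: Order.Disp tt tt. Qed.

Inductive otimes (r : nat) (Q1 Q2 : Type) : predArgType :=
  | OLow of Q1
  | OMid of 'I_r
  | OUp of Q2.

Arguments OLow {r Q1 Q2}.
Arguments OMid {r Q1 Q2}.
Arguments OUp {r Q1 Q2}.

Section OtimesFinite.

Variables (r : nat) (Q1 Q2 : Type).

Definition otimes_to_sum (x : otimes r Q1 Q2) : Q1 + 'I_r + Q2 :=
  match x with
  | OLow q => inl (inl q)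
  | OMid k => inl (inr k)
  | OUp q => inr q
  end.

Definition otimes_of_sum (s : Q1 + 'I_r + Q2) : otimes r Q1 Q2 :=
  match s with
  | inl (inl q) => OLow q
  | inl (inr k) => OMid k
  | inr q => OUp q
  end.

Lemma otimes_to_sumK : cancel otimes_to_sum otimes_of_sum.
Proof. by case. Qed.

End OtimesFinite.

HB.instance Definition _ (r : nat) (Q1 Q2 : finType) :=
  Finite.copy (otimes r Q1 Q2) (can_type (@otimes_to_sumK r Q1 Q2)).

Section OtimesOrder.

Variables (d1 d2 : Order.disp_t) (r : nat).
Variables (Q1 : finPOrderType d1) (Q2 : finPOrderType d2).

Definition otimes_le (x y : otimes r Q1 Q2) : bool :=
  match x, y with
  | OLow a, OLow b => (a <= b)%O
  | OLow _, _ => true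
  | OMid k, OMid l => k == l
  | OMid _, OUp _ => true
  | OUp a, OUp b => (a <= b)%O
  | _, _ => false
  end.

Lemma otimes_le_refl : reflexive otimes_le.
Proof. by case=> a /=. Qed.

Lemma otimes_le_anti : antisymmetric otimes_le.
Proof.
case=> a [] b //=; first by move=> /Order.POrderTheory.le_anti ->.
  by case/andP=> /eqP ->.
by move=> /Order.POrderTheory.le_anti ->.
Qed.

Lemma otimes_le_trans : transitive otimes_le.
Proof.
case=> b [] a [] c //=; try exact: Order.POrderTheory.le_trans.
by move=> /eqP ->.
Qed.

HB.instance Definition _ :=
  Order.Le_isPOrder.Build (otimes_display d1 d2) (otimes r Q1 Q2)
    otimes_le_refl otimes_le_anti otimes_le_trans.

End OtimesOrder.

Definition full_level (n k : nat) : {set {set 'I_n}} :=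
  [set A : {set 'I_n} | #|A| == k].

(* gamma r F is \gamma^r_{0,m}(F): an unordered r-tuple of different members
   of F is an r-element subset of F. *)
Definition gamma (r m : nat) (F : {set {set 'I_m}}) : nat :=
  #|[set G : {set {set 'I_m}} |
      [&& G \subset F, #|G| == r,
          \bigcap_(A in G) A == set0 & \bigcup_(A in G) A == setT]]|.

Definition union_of_full_levels (n : nat) (F : {set {set 'I_n}}) : Prop :=
  exists S : {set 'I_n.+1}, F = \bigcup_(k in S) full_level n k.

Definition level_conj_strongly (dP dQ : Order.disp_t)
    (P : finPOrderType dP) (Q : finPOrderType dQ) : Prop :=
  exists N : nat, forall n : nat, N <= n ->
    exists F : {set {set 'I_n}},
      [/\ poset_free P F, union_of_full_levels F & La n P Q = copies Q F].

(* The estimate La(n,P,Q) = O(n^k c(Q,F_n)), as n tends to infinity, is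
   spelled out with an explicit constant C and threshold N. *)
Definition level_conj_almost (dP dQ : Order.disp_t)
    (P : finPOrderType dP) (Q : finPOrderType dQ) : Prop :=
  exists F : forall n : nat, {set {set 'I_n}},
    (forall n : nat, poset_free P (F n) /\ union_of_full_levels (F n)) /\
    exists k C N : nat, forall n : nat, N <= n ->
      La n P Q <= C * (n ^ k * copies Q (F n)).

(* Main.v *)
From Stdlib Require Import Classical.
Require Import Defs.
From mathcomp Require Import all_boot all_order.
From mathcomp Require Import zify.

(* Let l1, l2 be the heights of Q1, Q2.  In a family F without chains of length l1 + l2 + 2,
   the sets playing the role of the middle elements m_k have a chain of length l1 of F
   below them and one of length l2 above them, so together they form an antichain A.  A copy
   of the product is an r-subset R of A, a copy of Q1 below the intersection of R and a copy
   of Q2 above its union; both parts live in families without chains of length l1 + 1,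
   resp. l2 + 1.  For r = 1 one sums over A with the LYM inequality.

   For r >= 2 one needs that, up to a polynomial factor, no antichain of subsets of [m]
   contains more r-subsets with empty intersection and full union than the middle level.
   The ordered r-tuples of this kind, on all levels, number (2 ^ r - 2) ^ m.  For m = 2h a
   proportion of at least (h + 1) ^ - r of them lies in the middle level: by Cauchy-Schwarz
   many pairs of tuples on the two halves of [m] have the same size vector, and
   complementing one of them makes all sizes equal to h.  For odd m and r >= 3 one adds a
   point by a local move, while for r = 2 the interval is shortened by one point.

   For the statements on full levels, La(n-1) <= La(n) <= c La(n-1) for large n: a copy in
   2 ^ [n] does not separate a positive proportion of the pairs of points, and such a pair
   can be merged.  As the multinomial coefficient gains a factor of order n when
   a unit is moved from a part of size of order n to a bounded part, the maximum is reached
   with all parts large, where the level conjecture applies.  In the exact statement for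
   r = 1 the set m_1 must not occur again as top of the family for Q1 (or bottom of that for
   Q2); a level family using the full set is not optimal, by a comparison of exponential
   rates.  *)

Set Implicit Arguments.
Unset Strict Implicit.
Unset Printing Implicit Defensive.

(** * Copies, chains and heights *)

Definition sproper (T : finType) : rel {set T} := fun A B => A \proper B.

Section Copies.
Variables (d : Order.disp_t) (P : finPOrderType d).

Lemma is_copyP (T : finType) (G : {set {set T}}) :
  reflect (exists phi : P -> {set T},
    [/\ injective phi, forall x y, (x <= y)%O -> phi x \subset phi y
      & G = [set phi x | x : P]]) (is_copy P G).
Proof.
apply: (iffP existsP) => [[phi /and3P[/injectiveP inj /eqP <- /forallP mon]]|].
  by exists phi; split=> // x y le_xy; move/forallP: (mon x) => /(_ y) /implyP ->.
case=> phi [inj mon ->]; exists (finfun phi); apply/and3P; split.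
- by apply/injectiveP => x y; rewrite !ffunE => /inj.
- by apply/eqP/eq_imset => x; rewrite ffunE.
- by apply/forallP => x; apply/forallP => y; apply/implyP; rewrite !ffunE => /mon.
Qed.

Lemma card_copy (T : finType) (G : {set {set T}}) : is_copy P G -> #|G| = #|P|.
Proof. by move=> /is_copyP[phi [inj _ ->]]; rewrite card_imset. Qed.

Lemma copies_subset (T : finType) (F F' : {set {set T}}) :
  F \subset F' -> copies P F <= copies P F'.
Proof.
move=> sFF'; apply: subset_leq_card; apply/subsetP => G.
by rewrite !inE => /andP[/subset_trans-> //].
Qed.

Lemma poset_freeP (T : finType) (F : {set {set T}}) :
  reflect (forall G : {set {set T}}, G \subset F -> ~~ is_copy P G) (poset_free P F).
Proof.
rewrite /poset_free /copies cards_eq0; apply: (iffP eqP) => [F0 G sGF|F0].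
  by apply/negP => cG; have := in_set0 G; rewrite -F0 inE sGF cG.
by apply/setP => G; rewrite !inE; apply/negP => /andP[/F0/negP].
Qed.

Lemma poset_free_subset (T : finType) (F F' : {set {set T}}) :
  F \subset F' -> poset_free P F' -> poset_free P F.
Proof.
by rewrite /poset_free -!leqn0 => sFF'; apply: leq_trans (copies_subset sFF').
Qed.

Section Embedding.
Variables (T' T : finType) (g : {set T'} -> {set T}).
Hypothesis gS : forall A B, (g A \subset g B) = (A \subset B).

Lemma embedding_inj : injective g.
Proof.
by move=> A B eqg; apply/eqP; rewrite eqEsubset -!gS eqg subxx.
Qed.

Lemma is_copy_embedding (G : {set {set T'}}) : is_copy P [set g A | A in G] = is_copy P G.
Proof.
apply/is_copyP/is_copyP => [[phi [inj mon eG]]|[phi [inj mon ->]]]; last first.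
  exists (g \o phi); split; first exact: inj_comp embedding_inj inj.
    by move=> x y /mon /=; rewrite gS.
  by rewrite -imset_comp.
have /fin_all_exists[psi psiE] x : exists A, g A = phi x.
  have : phi x \in [set g A | A in G] by rewrite eG imset_f.
  by case/imsetP => A _ ->; exists A.
exists psi; split.
- by move=> x y eq_psi; apply: inj; rewrite -!psiE eq_psi.
- by move=> x y /mon; rewrite -!psiE gS.
- apply: (imset_inj embedding_inj); rewrite eG -imset_comp.
  by apply: eq_imset => x; rewrite /= psiE.
Qed.

(** As [g] both preserves and reflects inclusion, taking images under [g] is a bijection from the
    copies in [F] to those in its image. *)
Lemma copies_embedding (F : {set {set T'}}) : copies P [set g A | A in F] = copies P F.
Proof.
rewrite /copies -(card_imset _ (imset_inj embedding_inj)); apply: eq_card => G.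
rewrite inE; apply/andP/imsetP => [[sGF cG]|[G']]; last first.
  by rewrite inE => /andP[sG' cG'] ->; rewrite imsetS ?is_copy_embedding.
have eG : G = [set g A | A in g @^-1: G].
  apply/setP => A; apply/idP/imsetP => [AG|[B]]; last by rewrite inE => BG ->.
  by have /imsetP[B _ eA] := subsetP sGF _ AG; exists B; rewrite // inE -eA.
exists (g @^-1: G) => //; rewrite inE -is_copy_embedding -eG cG andbT.
apply/subsetP => A; rewrite inE => /(subsetP sGF) /imsetP[B BF].
by move/embedding_inj->.
Qed.

Lemma imset_preimset_embedding (F : {set {set T}}) :
  (forall A, A \in F -> exists B, g B = A) ->
  [set g A | A in g @^-1: F] = F.
Proof.
move=> Fg; apply/setP => A; apply/imsetP/idP => [[B]|AF]; first by rewrite inE => BF ->.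
by have [B eA] := Fg _ AF; exists B; rewrite ?inE eA.
Qed.

End Embedding.
End Copies.

Section Chains.

Lemma proper_trans_rel (T : finType) : transitive (@sproper T).
Proof. by move=> A B C; apply: proper_trans. Qed.

Lemma sorted_proper_uniq (T : finType) (s : seq {set T}) :
  sorted (@sproper T) s -> uniq s.
Proof.
by apply: (sorted_uniq (@proper_trans_rel T)) => A; apply: properxx.
Qed.

(** For chains the weak notion of copy loses nothing: an injective monotone image of ['I_k] is
    strictly increasing. *)
Lemma chain_freeP (T : finType) (F : {set {set T}}) k :
  reflect (forall s, sorted (@sproper T) s -> {subset s <= F} -> size s <> k)
          (poset_free (chain_poset k) F).
Proof.
apply: (iffP (poset_freeP _ _)) => [F0 s srt_s sF sz_s|F0 G sGF].
  have sGF : [set A in s] \subset F by apply/subsetP => A; rewrite inE => /sF.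
  case/negP: (F0 _ sGF).
  apply/is_copyP; exists (fun i : 'I_k => nth set0 s i); split.
  - move=> i j /eqP; rewrite nth_uniq ?sz_s ?sorted_proper_uniq //.
    by move/eqP/val_inj.
  - move=> i j; rewrite leEord leq_eqVlt => /orP[/eqP/val_inj-> //|lt_ij].
    apply: proper_sub; apply: (sorted_ltn_nth (@proper_trans_rel T)) => //;
      by rewrite inE sz_s.
  - apply/setP => A; rewrite inE; apply/idP/imsetP => [As|[i _ ->]].
      have lt_i : index A s < k by rewrite -sz_s index_mem.
      by exists (Ordinal lt_i); rewrite //= nth_index.
    by rewrite mem_nth // sz_s.
apply/negP => /is_copyP[phi [inj mon eG]].
case: (F0 [seq phi i | i <- enum 'I_k]).
- have: sorted (relpre val ltn) (enum 'I_k).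
    by rewrite -sorted_map val_enum_ord iota_ltn_sorted.
  apply: homo_sorted => i j /= lt_ij.
  rewrite /sproper properEneq mon ?andbT; last by rewrite leEord ltnW.
  by apply/eqP => /inj eij; rewrite eij ltnn in lt_ij.
- by move=> A /mapP[i _ ->]; apply: (subsetP sGF); rewrite eG imset_f.
- by rewrite size_map size_enum_ord.
Qed.

End Chains.

Section Height.
Variables (d : Order.disp_t) (Q : finPOrderType d).

Lemma height_chain :
  exists s : seq Q, sorted (fun x y => (x < y)%O) s /\ size s = height Q.
Proof.
have [A chA <-] : exists2 A : {set Q}, is_chain A & #|A| = height Q.
  have ne : 0 < #|@is_chain _ Q|.
    by apply/card_gt0P; exists set0; apply/forall_inP => x; rewrite inE.
  have [A chA eA] := eq_bigmax_cond (fun A : {set Q} => #|A|) ne.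
  by exists A; rewrite // -eA.
exists (sort (fun x y => (x <= y)%O) (enum A)).
rewrite size_sort -cardE; split=> //.
rewrite Order.POrderTheory.lt_sorted_uniq_le sort_uniq enum_uniq /=.
apply: (sort_sorted_in (P := [in A])); last by apply/allP => x; rewrite mem_enum.
by move=> x y xA yA; have /forall_inP/(_ _ xA)/forall_inP/(_ _ yA) := chA.
Qed.

Lemma leq_height (s : seq Q) : sorted (fun x y => (x < y)%O) s -> size s <= height Q.
Proof.
rewrite Order.POrderTheory.lt_sorted_uniq_le => /andP[us srt_s].
rewrite -(card_uniqP us).
have -> : #|s| = #|[set x in s]| by rewrite cardsE.
apply: leq_bigmax_cond; apply/forall_inP => x; rewrite inE => xs.
apply/forall_inP => y; rewrite inE => ys; rewrite /Order.comparable.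
have ixs : index x s < size s by rewrite index_mem.
have iys : index y s < size s by rewrite index_mem.
rewrite -(nth_index x xs) -(nth_index x ys).
have le_nth := sorted_leq_nth Order.POrderTheory.le_trans Order.POrderTheory.le_refl x srt_s.
by case/orP: (leq_total (index x s) (index y s)) => le_i;
  rewrite (le_nth _ _ _ _ le_i) ?inE ?ixs ?iys ?orbT.
Qed.

Lemma leq_card_chain (A : {set Q}) : is_chain A -> #|A| <= height Q.
Proof. by move=> chA; apply: leq_bigmax_cond. Qed.

(** The image of a longest chain of [Q]. Through this, copies of [Q1] and [Q2] force long chains in
    a family. *)
Lemma copy_chain (T : finType) (G : {set {set T}}) : is_copy Q G ->
  exists s, [/\ sorted (@sproper T) s, {subset s <= G} & size s = height Q].
Proof.
case/is_copyP => phi [inj mon ->]; have [s [srt_s <-]] := height_chain.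
exists (map phi s); split; last by rewrite size_map.
  apply: homo_sorted srt_s => x y; rewrite Order.POrderTheory.lt_neqAle => /andP[neq_xy le_xy].
  by rewrite /sproper properEneq mon // andbT (inj_eq inj).
by move=> A /mapP[x _ ->]; apply: imset_f.
Qed.

End Height.

(** * Copies of the product poset *)

Section Intervals.
Variables (T : finType) (I D : {set T}).

(** For disjoint [I] and [D] this is an isomorphism from the cube of dimension [#|D|] onto the
    interval between [I] and [I :|: D]. *)
Definition interval_embedding (A : {set 'I_#|D|}) : {set T} :=
  I :|: [set enum_val x | x in A].

Hypothesis disjID : [disjoint I & D].

Lemma interval_embeddingS (A B : {set 'I_#|D|}) :
  (interval_embedding A \subset interval_embedding B) = (A \subset B).
Proof.
apply/idP/idP => [sAB|sAB]; last by apply/setUS/imsetS.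
apply/subsetP => x xA; have : enum_val x \in interval_embedding B.
  by apply: (subsetP sAB); rewrite inE imset_f ?orbT.
rewrite inE => /orP[xI|/imsetP[y yB /enum_val_inj-> //]].
by have := disjointFr disjID xI; rewrite enum_valP.
Qed.

Lemma interval_embedding_surj (A : {set T}) :
  I \subset A -> A \subset I :|: D -> exists B, interval_embedding B = A.
Proof.
move=> sIA sAJ; exists [set x | enum_val x \in A]; apply/setP => y; rewrite inE.
apply/orP/idP => [[/(subsetP sIA)//|/imsetP[x]]|yA]; first by rewrite inE => xA ->.
have := subsetP sAJ y yA; rewrite inE => /orP[->|yD]; [by left|right].
by apply/imsetP; exists (enum_rank_in yD y); rewrite ?inE enum_rankK_in.
Qed.

Lemma card_interval_embedding (A : {set 'I_#|D|}) : #|interval_embedding A| = #|I| + #|A|.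
Proof.
rewrite cardsU (_ : I :&: _ = set0) ?cards0 ?subn0.
  by rewrite card_imset //; apply: enum_val_inj.
apply/setP => x; rewrite !inE; apply/negP => /andP[xI /imsetP[y _ ex]].
by have := disjointFr disjID xI; rewrite ex enum_valP.
Qed.

End Intervals.

Section LaBounds.
Variables (dP dQ : Order.disp_t) (P : finPOrderType dP) (Q : finPOrderType dQ).

Lemma leq_La n (F : {set {set 'I_n}}) : poset_free P F -> copies Q F <= La n P Q.
Proof. by move=> F0; apply: leq_bigmax_cond. Qed.

Lemma leq_La_embedding n (T : finType) (g : {set 'I_n} -> {set T}) (F : {set {set T}}) :
    (forall A B, (g A \subset g B) = (A \subset B)) ->
    (forall A, A \in F -> exists B, g B = A) ->
  poset_free P F -> copies Q F <= La n P Q.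
Proof.
move=> gS Fg; rewrite -(imset_preimset_embedding Fg) (copies_embedding Q gS).
by rewrite /poset_free (copies_embedding P gS) => /leq_La.
Qed.

Lemma leq_La_interval (T : finType) (I D : {set T}) (F : {set {set T}}) :
    [disjoint I & D] ->
    (forall A, A \in F -> (I \subset A) && (A \subset I :|: D)) ->
  poset_free P F -> copies Q F <= La #|D| P Q.
Proof.
move=> disjID FID; apply: (leq_La_embedding (interval_embeddingS disjID)) => A.
by case/FID/andP; apply: interval_embedding_surj.
Qed.

End LaBounds.

Section Otimes.
Variables (d1 d2 : Order.disp_t).
Variables (Q1 : finPOrderType d1) (Q2 : finPOrderType d2) (T : finType).
Implicit Types (F G R : {set {set T}}).

Definition strictly_below F R := [set A in F | [forall M in R, A \proper M]].
Definition strictly_above F R := [set A in F | [forall M in R, M \proper A]].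

Lemma strictly_belowP F R A :
  reflect (A \in F /\ forall M, M \in R -> A \proper M) (A \in strictly_below F R).
Proof.
rewrite inE; apply: (iffP andP) => -[AF ltA]; split=> //.
  by move=> M MR; apply: (forall_inP ltA).
exact/forall_inP.
Qed.

Lemma strictly_aboveP F R A :
  reflect (A \in F /\ forall M, M \in R -> M \proper A) (A \in strictly_above F R).
Proof.
rewrite inE; apply: (iffP andP) => -[AF ltA]; split=> //.
  by move=> M MR; apply: (forall_inP ltA).
exact/forall_inP.
Qed.

Definition split_copies (r : nat) (A F : {set {set T}}) :=
  [set p : {set {set T}} * ({set {set T}} * {set {set T}}) |
    [&& p.1 \subset A, #|p.1| == r,
        (p.2.1 \subset strictly_below F p.1) && is_copy Q1 p.2.1
      & (p.2.2 \subset strictly_above F p.1) && is_copy Q2 p.2.2]].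

Lemma card_split_copies r (A F : {set {set T}}) : #|split_copies r A F| =
  \sum_(R : {set {set T}} | (R \subset A) && (#|R| == r))
     copies Q1 (strictly_below F R) * copies Q2 (strictly_above F R).
Proof.
rewrite -sum1_card /=.
under [RHS]eq_bigr => R _ do rewrite /copies -cardsX -sum1_card.
by rewrite pair_big_dep /=; apply: eq_bigl => p; rewrite !inE andbA.
Qed.

(** The images of the three parts of the product form a triple of [split_copies] with union [G], so
    the union map hits every copy. *)
Lemma copies_otimes_le r F : copies (otimes r Q1 Q2) F <=
  \sum_(R : {set {set T}} | (R \subset F) && (#|R| == r))
     copies Q1 (strictly_below F R) * copies Q2 (strictly_above F R).
Proof.
rewrite -card_split_copies.
apply: (leq_trans _ (leq_imset_card (fun p => p.2.1 :|: p.1 :|: p.2.2) _)).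
apply: subset_leq_card; apply/subsetP => G; rewrite inE.
case/andP=> sGF /is_copyP[phi [inj mon eG]].
have lt_phi x y : (x <= y)%O -> x != y -> phi x \proper phi y.
  by move=> le_xy neq_xy; rewrite properEneq mon // (inj_eq inj) neq_xy.
have phiF x : phi x \in F by apply: (subsetP sGF); rewrite eG imset_f.
apply/imsetP; exists ([set phi (OMid k) | k : 'I_r],
    ([set phi (OLow q) | q : Q1], [set phi (OUp q) | q : Q2])) => /=; last first.
  rewrite eG; apply/setP => A; rewrite !inE; apply/imsetP/idP => [[[q|k|q] _ ->]|].
  - by rewrite imset_f.
  - by rewrite (imset_f (fun k => phi (OMid k))) ?orbT.
  - by rewrite (imset_f (fun q => phi (OUp q))) ?orbT.
  by case/orP => [/orP[]|] /imsetP[x _ ->]; eexists.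
rewrite inE /=; apply/and4P; split.
- by apply/subsetP => A /imsetP[k _ ->].
- by rewrite card_imset ?card_ord // => k l /inj[].
- apply/andP; split; last first.
    apply/is_copyP; exists (fun q => phi (OLow q)); split=> // [x y /inj[]//|x y le_xy].
    exact: mon.
  apply/subsetP => A /imsetP[q _ ->]; apply/strictly_belowP; split=> // M /imsetP[k _ ->].
  exact: lt_phi.
- apply/andP; split; last first.
    apply/is_copyP; exists (fun q => phi (OUp q)); split=> // [x y /inj[]//|x y le_xy].
    exact: mon.
  apply/subsetP => A /imsetP[q _ ->]; apply/strictly_aboveP; split=> // M /imsetP[k _ ->].
  exact: lt_phi.
Qed.

Definition antichain (A : {set {set T}}) :=
  forall M N, M \in A -> N \in A -> M \subset N -> M = N.

(** Middle sets from an antichain [A] can be read off the union of a triple: sets strictly below or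
    above a member of [A] lie outside [A]. So the union map is injective on triples, and its values
    are copies of the product. *)
Lemma copies_otimes_ge r F (A : {set {set T}}) : 0 < r -> A \subset F -> antichain A ->
  \sum_(R : {set {set T}} | (R \subset A) && (#|R| == r))
     copies Q1 (strictly_below F R) * copies Q2 (strictly_above F R) <=
  copies (otimes r Q1 Q2) F.
Proof.
move=> r_gt0 sAF acA; rewrite -card_split_copies.
have member p : p \in split_copies r A F -> exists2 M, M \in p.1 & M \in A.
  rewrite inE => /and4P[/subsetP sR /eqP cR _ _].
  have /set0Pn[M MR] : p.1 != set0 by rewrite -cards_eq0 cR -lt0n.
  by exists M => //; apply: sR.
rewrite -(@card_in_imset _ _ (fun p => p.2.1 :|: p.1 :|: p.2.2)); last first.
  (* Once [R] is recovered as the trace on [A], the outer parts are the members of the union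
     strictly below and strictly above [R]. *)
  have mid p : p \in split_copies r A F ->
      p = ((p.2.1 :|: p.1 :|: p.2.2) :&: A,
           (strictly_below (p.2.1 :|: p.1 :|: p.2.2) ((p.2.1 :|: p.1 :|: p.2.2) :&: A),
            strictly_above (p.2.1 :|: p.1 :|: p.2.2) ((p.2.1 :|: p.1 :|: p.2.2) :&: A))).
    move=> pU; have [M MR MA] := member p pU; move: pU.
    rewrite inE; case: p MR => R [G1 G2] /= MR /and4P[/subsetP sRA _].
    move=> /andP[/subsetP sG1 _] /andP[/subsetP sG2 _].
    have eR : (G1 :|: R :|: G2) :&: A = R.
      apply/setP => N; rewrite !inE; apply/andP/idP => [[NG NA]|NR]; last first.
        by rewrite NR orbT sRA.
      case/orP: NG => [/orP[/sG1/strictly_belowP[_ /(_ _ MR)]|//]|].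
        by move=> ltNM; move: (ltNM); rewrite (acA N M) ?properxx // proper_sub.
      move=> /sG2/strictly_aboveP[_ /(_ _ MR)] ltMN.
      by move: (ltMN); rewrite (acA M N) ?properxx // proper_sub.
    rewrite eR; congr (_, (_, _)).
      apply/setP => B; apply/idP/strictly_belowP => [BG1|[]].
        split; first by rewrite !inE BG1.
        by case/sG1/strictly_belowP: BG1.
      move=> + ltB; rewrite !inE => /orP[/orP[//|/ltB]|/sG2]; first by rewrite properxx.
      case/strictly_aboveP => _ /(_ _ MR) ltMB.
      by have := proper_trans ltMB (ltB _ MR); rewrite properxx.
    apply/setP => B; apply/idP/strictly_aboveP => [BG2|[]].
      split; first by rewrite !inE BG2 orbT.
      by case/sG2/strictly_aboveP: BG2.
    move=> + ltB; rewrite !inE => /orP[/orP[/sG1|/ltB]|//]; last by rewrite properxx.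
    case/strictly_belowP => _ /(_ _ MR) ltMB.
    by have := proper_trans ltMB (ltB _ MR); rewrite properxx.
  by move=> p p' /mid ep /mid ep' /= eqG; rewrite ep ep' eqG.
apply: subset_leq_card; apply/subsetP => G /imsetP[p pU ->{G}].
have [M MR MA] := member p pU; move: pU; rewrite !inE.
case: p MR => R [G1 G2] /= MR /and4P[/subsetP sRA /eqP cR].
case/andP=> /subsetP sG1 /is_copyP[phi1 [inj1 mon1 eG1]].
case/andP=> /subsetP sG2 /is_copyP[phi2 [inj2 mon2 eG2]].
have ltG1 q N : N \in R -> phi1 q \proper N.
  by move=> NR; have /sG1/strictly_belowP[_ ->] : phi1 q \in G1 by rewrite eG1 imset_f.
have ltG2 q N : N \in R -> N \proper phi2 q.
  by move=> NR; have /sG2/strictly_aboveP[_ ->] : phi2 q \in G2 by rewrite eG2 imset_f.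
(* Any enumeration of [R] serves, since the middle elements form an antichain. *)
pose mid (k : 'I_r) := enum_val (cast_ord (esym cR) k).
have midR k : mid k \in R by apply: enum_valP.
have lt12 q q' : phi1 q \proper phi2 q' by apply: proper_trans (ltG1 _ _ MR) (ltG2 _ _ MR).
apply/andP; split.
  apply/subsetP => B; rewrite !inE => /orP[/orP[/sG1/strictly_belowP[]|/sRA/(subsetP sAF)]|] //.
  by case/sG2/strictly_aboveP.
apply/is_copyP; exists (fun x => match x with
  | OLow q => phi1 q | OMid k => mid k | OUp q => phi2 q end); split.
- have neq (B C : {set T}) : B \proper C -> B = C -> False by move=> + eBC; rewrite eBC properxx.
  case=> [q|k|q] [q'|k'|q'] eqB.
  + by rewrite (inj1 _ _ eqB).
  + by case: (neq _ _ (ltG1 q _ (midR k')) eqB).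
  + by case: (neq _ _ (lt12 q q') eqB).
  + by case: (neq _ _ (ltG1 q' _ (midR k)) (esym eqB)).
  + by rewrite (cast_ord_inj (enum_val_inj eqB)).
  + by case: (neq _ _ (ltG2 q' _ (midR k)) eqB).
  + by case: (neq _ _ (lt12 q' q) (esym eqB)).
  + by case: (neq _ _ (ltG2 q _ (midR k')) (esym eqB)).
  + by rewrite (inj2 _ _ eqB).
- case=> [q|k|q] [q'|k'|q'] //=; rewrite /Order.le /= => lexy.
  + exact: mon1.
  + by rewrite proper_sub // ltG1.
  + by rewrite proper_sub.
  + by rewrite (eqP lexy).
  + by rewrite proper_sub // ltG2.
  + exact: mon2.
- apply/setP => B; rewrite !inE; apply/idP/imsetP.
    case/orP=> [/orP[]|]; rewrite ?eG1 ?eG2.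
    + by case/imsetP => q _ ->; exists (OLow q).
    + move=> BR; have lt_r : enum_rank_in BR B < r by rewrite -cR.
      exists (OMid (Ordinal lt_r)) => //; rewrite /mid.
      rewrite (_ : cast_ord _ _ = enum_rank_in BR B) ?enum_rankK_in //.
      exact: val_inj.
    + by case/imsetP => q _ ->; exists (OUp q).
  by case=> [[q|k|q]] _ ->; rewrite ?eG1 ?eG2 ?midR ?imset_f ?orbT.
Qed.

End Otimes.

(** * The LYM inequality and the antichain of middle sets *)

Section LYM.

(** Induction on [n]: delete a point [x] of [U] and keep the sets avoiding [x]. Summed over [x], a
    set [B] is counted [n.+1 - #|B|] times, which raises the second factorial of its weight by one
    step. *)
Lemma LYM_in (T : finType) n (U : {set T}) (A : {set {set T}}) : #|U| = n -> antichain A ->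
    (forall B, B \in A -> B \subset U) ->
  \sum_(B in A) #|B|`! * (n - #|B|)`! <= n`!.
Proof.
elim: n U A => [|n IHn] U A cU acA sAU.
  apply: (@leq_trans #|A|).
    rewrite -sum1_card; apply: leq_sum => B /sAU.
    by move: cU => /eqP; rewrite cards_eq0 => /eqP->; rewrite subset0 => /eqP->; rewrite cards0.
  have U0 : U = set0 by apply/eqP; rewrite -cards_eq0 cU.
  rewrite fact0 -(cards1 (set0 : {set T})) subset_leq_card //.
  by apply/subsetP => B /sAU; rewrite U0 subset0 inE.
(* The set [U] avoids no point and would be lost by the deletion, but it can only occur as the sole
   member of [A]. *)
case: (boolP (U \in A)) => [UA|UnA].
  have -> : A = [set U].
    by apply/setP => B; rewrite inE; apply/idP/eqP => [BA|-> //]; apply: acA => //; apply: sAU.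
  by rewrite big_set1 cU subnn muln1.
have ltB B : B \in A -> #|B| <= n.
  move=> BA; rewrite -ltnS -cU; apply: proper_card.
  by rewrite properEneq sAU // andbT; apply: contraNneq UnA => <-.
rewrite factS -[X in _ <= X * _]cU.
have le_sum : \sum_(x in U) \sum_(B in [set B in A | x \notin B]) #|B|`! * (n - #|B|)`! <=
    #|U| * n`!.
  rewrite -sum_nat_const; apply: leq_sum => x xU; apply: (IHn (U :\ x)).
  - by have := cardsD1 x U; rewrite cU xU => -[].
  - by move=> M N; rewrite !inE => /andP[MA _] /andP[NA _]; apply: acA.
  - by move=> B; rewrite inE subsetD1 => /andP[/sAU -> ->].
apply: leq_trans le_sum.
under [X in _ <= X]eq_bigr => x _ do under eq_bigl => B do rewrite inE.
rewrite (exchange_big_dep (mem A)) /=; last by move=> x B _ /andP[].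
apply/eq_leq/eq_bigr => B BA.
rewrite (eq_bigl (mem (U :\: B))); last by move=> x; rewrite !inE BA andbC.
by rewrite sum_nat_const cardsD (setIidPr (sAU B BA)) cU subSn ?ltB // factS mulnCA.
Qed.

Lemma LYM n (A : {set {set 'I_n}}) : antichain A ->
  \sum_(B in A) #|B|`! * (n - #|B|)`! <= n`!.
Proof.
move=> acA; apply: (@LYM_in _ _ setT) => //; by rewrite cardsT card_ord.
Qed.

Lemma bin_fact_ord n (B : {set 'I_n}) : 'C(n, #|B|) * (#|B|`! * (n - #|B|)`!) = n`!.
Proof. by rewrite bin_fact // -[leqRHS]card_ord max_card. Qed.

(** The inverse binomial coefficients of the sizes sum to at most 1 over an antichain, so a bound
    valid for the total weight of every full level is valid for every antichain. *)
Lemma LYM_weighted n (A : {set {set 'I_n}}) (f : nat -> nat) m : antichain A ->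
    (forall k, k <= n -> 'C(n, k) * f k <= m) ->
  \sum_(B in A) f #|B| <= m.
Proof.
move=> acA le_m; rewrite -(leq_pmul2r (fact_gt0 n)) big_distrl /=.
apply: (@leq_trans (\sum_(B in A) m * (#|B|`! * (n - #|B|)`!))).
  apply: leq_sum => B _; rewrite -(bin_fact_ord B) mulnA leq_mul2r; apply/orP; right.
  by rewrite mulnC le_m // -[leqRHS]card_ord max_card.
by rewrite -big_distrr leq_mul2l LYM ?orbT.
Qed.

Lemma leq_bin_half n k : 'C(n, k) <= 'C(n, n %/ 2).
Proof.
case: (leqP k n) => [le_kn|]; last by move=> /bin_small ->.
have up j : j < n %/ 2 -> 'C(n, j) <= 'C(n, j.+1).
  move=> lt_j; rewrite -(leq_pmul2l (ltn0Sn j)) mul_bin_left leq_mul2r.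
  by apply/orP; right; lia.
have upto j i : i + j <= n %/ 2 -> 'C(n, i) <= 'C(n, i + j).
  elim: j => [|j IHj] le_ij; first by rewrite addn0.
  by rewrite addnS in le_ij *; apply: leq_trans (IHj (ltnW le_ij)) (up _ le_ij).
case: (leqP k (n %/ 2)) => [le_k|lt_k].
  by have := upto (n %/ 2 - k) k; rewrite subnKC // => ->.
rewrite -(bin_sub le_kn); have := upto (n %/ 2 - (n - k)) (n - k).
by rewrite subnKC ?leqnn; [apply | lia].
Qed.

Lemma sperner n (A : {set {set 'I_n}}) : antichain A -> #|A| <= 'C(n, n %/ 2).
Proof.
move=> acA; rewrite -sum1_card; apply: (LYM_weighted acA (f := fun=> 1)) => k _.
by rewrite muln1 leq_bin_half.
Qed.

Lemma antichain_full_level n k : antichain (full_level n k).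
Proof.
move=> M N; rewrite !inE => /eqP cM /eqP cN sMN; apply/eqP.
by rewrite eqEcard sMN cM cN /=.
Qed.

Lemma card_full_level n k : #|full_level n k| = 'C(n, k).
Proof.
by rewrite -[n in 'C(n, _)]card_ord -cardsT -cards_draws; apply: eq_card => A; rewrite !inE subsetT.
Qed.

Lemma leq_central_bin n : n <= 'C(n, n %/ 2).
Proof. by rewrite -{1}(bin1 n) leq_bin_half. Qed.

End LYM.

Section OtimesUpper.
Variables (d1 d2 : Order.disp_t).
Variables (Q1 : finPOrderType d1) (Q2 : finPOrderType d2).

Lemma height_otimes r : 0 < r -> height (otimes r Q1 Q2) = height Q1 + height Q2 + 1.
Proof.
move=> r_gt0; apply/eqP; rewrite eqn_leq; apply/andP; split.
  apply/bigmax_leqP => A chA.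
  have comp x y : x \in A -> y \in A -> (x >=< y)%O.
    by move=> xA yA; have /forall_inP/(_ _ xA)/forall_inP/(_ _ yA) := chA.
  pose A1 := OLow @^-1: A; pose Am := OMid @^-1: A; pose A2 := OUp @^-1: A.
  have -> : A = [set OLow x | x in A1] :|: [set OUp x | x in A2] :|: [set OMid x | x in Am].
    apply/setP => x; apply/idP/idP; rewrite !inE.
      by case: x => [x|k|x] xA; apply/orP; [left; apply/orP; left|right|left; apply/orP; right];
        apply/imsetP; eexists; rewrite ?inE //.
    by case/orP=> [/orP[]|] /imsetP[y]; rewrite inE => ? ->.
  have inj1 : injective (@OLow r Q1 Q2) by move=> x y [].
  have inj2 : injective (@OUp r Q1 Q2) by move=> x y [].
  have injm : injective (@OMid r Q1 Q2) by move=> x y [].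
  apply: leq_trans (leq_card_setU _ _) _; apply: leq_add; last first.
    (* Two different middle elements are incomparable, so a chain contains at most one. *)
    rewrite card_imset // leqNgt; apply/negP => /card_gt1P[k [l [kA lA neq_kl]]].
    rewrite !inE in kA lA; have := comp _ _ kA lA.
    by rewrite /Order.comparable /Order.le /= [l == k]eq_sym orbb (negPf neq_kl).
  apply: leq_trans (leq_card_setU _ _) _.
  rewrite !card_imset //; apply: leq_add; apply: leq_card_chain;
    apply/forall_inP => x; rewrite inE => xA; apply/forall_inP => y; rewrite inE => yA;
    exact: (comp _ _ xA yA).
have [s1 [srt1 <-]] := height_chain Q1; have [s2 [srt2 <-]] := height_chain Q2.
pose s := map OLow s1 ++ OMid (Ordinal r_gt0) :: map OUp s2.
have -> : size s1 + size s2 + 1 = size s by rewrite size_cat /= !size_map; lia.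
apply: leq_height; rewrite (sorted_pairwise Order.POrderTheory.lt_trans).
rewrite pairwise_cat /= !pairwise_map.
rewrite (sorted_pairwise Order.POrderTheory.lt_trans) in srt1.
rewrite (sorted_pairwise Order.POrderTheory.lt_trans) in srt2.
apply/and4P; split.
- by apply/allrelP => x y /mapP[x' _ ->]; rewrite inE => /orP[/eqP->|/mapP[y' _ ->]].
- apply: sub_pairwise srt1 => x y; rewrite /= !Order.POrderTheory.lt_neqAle => /andP[neq_xy le_xy].
  by rewrite /Order.le /= le_xy andbT; apply: contraNneq neq_xy => -[->].
- by apply/allP => x /mapP[x' _ ->].
- apply: sub_pairwise srt2 => x y; rewrite /= !Order.POrderTheory.lt_neqAle => /andP[neq_xy le_xy].
  by rewrite /Order.le /= le_xy andbT; apply: contraNneq neq_xy => -[->].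
Qed.

Lemma sorted_proper_cat (T : finType) (s1 s2 : seq {set T}) :
    sorted (@sproper T) s1 -> sorted (@sproper T) s2 ->
    (forall A B, A \in s1 -> B \in s2 -> A \proper B) ->
  sorted (@sproper T) (s1 ++ s2).
Proof.
rewrite !(sorted_pairwise (@proper_trans_rel T)) pairwise_cat => -> -> lt12.
by rewrite !andbT; apply/allrelP.
Qed.

Section FreeFamily.
Variables (T : finType) (F : {set {set T}}).
Hypothesis F_free : poset_free (chain_poset (height Q1 + height Q2 + 2)) F.
Local Notation below := (strictly_below F).
Local Notation above := (strictly_above F).

Lemma below_chain (R : {set {set T}}) M : 0 < copies Q1 (below R) -> M \in R ->
  exists s, [/\ sorted (@sproper T) s, {subset s <= F}, size s = height Q1
    & forall A, A \in s -> A \proper M].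
Proof.
case/card_gt0P=> G; rewrite inE => /andP[/subsetP sG /copy_chain[s [srt_s sub_s sz_s]]] MR.
exists s; split=> // A /sub_s /sG /strictly_belowP[] // _; exact.
Qed.

Lemma above_chain (R : {set {set T}}) M : 0 < copies Q2 (above R) -> M \in R ->
  exists s, [/\ sorted (@sproper T) s, {subset s <= F}, size s = height Q2
    & forall A, A \in s -> M \proper A].
Proof.
case/card_gt0P=> G; rewrite inE => /andP[/subsetP sG /copy_chain[s [srt_s sub_s sz_s]]] MR.
exists s; split=> // A /sub_s /sG /strictly_aboveP[] // _; exact.
Qed.

Lemma long_chain_contra (s1 s2 : seq {set T}) :
    sorted (@sproper T) s1 -> sorted (@sproper T) s2 ->
    (forall A B, A \in s1 -> B \in s2 -> A \proper B) ->
    {subset s1 <= F} -> {subset s2 <= F} ->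
  size s1 + size s2 <> height Q1 + height Q2 + 2.
Proof.
move=> srt1 srt2 lt12 sF1 sF2; rewrite -size_cat.
apply: (chain_freeP _ _ F_free); first exact: sorted_proper_cat.
by move=> A; rewrite mem_cat => /orP[/sF1|/sF2].
Qed.

Lemma sorted_cons_proper (M : {set T}) s : sorted (@sproper T) s ->
  (forall A, A \in s -> M \proper A) -> sorted (@sproper T) (M :: s).
Proof.
move=> srt_s ltM; apply: (@sorted_proper_cat _ [:: M]) => // A B.
by rewrite inE => /eqP-> /ltM.
Qed.

(** A chain of [height Q1 + 1] sets below [M], then [M], then the [height Q2] sets above it given by
    a copy of [Q2], would be a forbidden chain. *)
Lemma below_free (R : {set {set T}}) : R \subset F -> R != set0 -> 0 < copies Q2 (above R) ->
  poset_free (chain_poset (height Q1 + 1)) (below R).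
Proof.
move=> /subsetP sRF /set0Pn[M MR] c2; have [s2 [srt2 sF2 sz2 lt2]] := above_chain c2 MR.
apply/chain_freeP => s srt_s sF sz_s.
have ltM A : A \in s -> A \proper M by case/sF/strictly_belowP => _; apply.
apply: (@long_chain_contra s (M :: s2)) => //.
- exact: sorted_cons_proper.
- move=> A B /ltM ltAM; rewrite inE => /orP[/eqP->//|/lt2]; exact: proper_trans.
- by move=> A /sF/strictly_belowP[].
- by move=> A; rewrite inE => /orP[/eqP->|/sF2//]; apply: sRF.
- by rewrite /= sz_s sz2; lia.
Qed.

Lemma above_free (R : {set {set T}}) : R \subset F -> R != set0 -> 0 < copies Q1 (below R) ->
  poset_free (chain_poset (height Q2 + 1)) (above R).
Proof.
move=> /subsetP sRF /set0Pn[M MR] c1; have [s1 [srt1 sF1 sz1 lt1]] := below_chain c1 MR.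
apply/chain_freeP => s srt_s sF sz_s.
have ltM A : A \in s -> M \proper A by case/sF/strictly_aboveP => _; apply.
apply: (@long_chain_contra s1 (M :: s)) => //.
- exact: sorted_cons_proper.
- move=> A B /lt1 ltAM; rewrite inE => /orP[/eqP->//|/ltM]; exact: proper_trans.
- by move=> A; rewrite inE => /orP[/eqP->|/sF/strictly_aboveP[]//]; apply: sRF.
- by rewrite /= sz_s sz1; lia.
Qed.

(** The sets [R] with a nonzero term in the sum of [copies_otimes_le]. *)
Definition active (R : {set {set T}}) :=
  (R \subset F) && (0 < copies Q1 (below R) * copies Q2 (above R)).

(** If [M] were strictly inside [N], the chain below [M], the sets [M] and [N], and the chain above
    [N] would form a forbidden chain; [M] and [N] may come from different active sets. *)
Lemma active_antichain : antichain (\bigcup_(R : {set {set T}} | active R) R).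
Proof.
move=> M N /bigcupP[R /andP[/subsetP sRF]]; rewrite muln_gt0 => /andP[c1 _] MR.
case/bigcupP=> R' /andP[/subsetP sRF']; rewrite muln_gt0 => /andP[_ c2] NR sMN.
have [s1 [srt1 sF1 sz1 lt1]] := below_chain c1 MR.
have [s2 [srt2 sF2 sz2 lt2]] := above_chain c2 NR.
apply/eqP; apply: contraT => neqMN.
have ltMN : M \proper N by rewrite properEneq neqMN.
have srtN := sorted_cons_proper srt2 lt2.
case: (@long_chain_contra s1 (M :: N :: s2)) => //.
- apply: sorted_cons_proper => // A; rewrite inE => /orP[/eqP->//|/lt2]; exact: proper_trans.
- move=> A B /lt1 ltAM; rewrite !inE => /or3P[/eqP->//|/eqP->|/lt2].
    exact: proper_trans ltMN.
  by move=> ltNB; apply: proper_trans ltAM (proper_trans ltMN ltNB).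
- by move=> A; rewrite !inE => /or3P[/eqP->|/eqP->|/sF2//]; [apply: sRF|apply: sRF'].
- by rewrite /= sz1 sz2; lia.
Qed.

Local Notation La1 n := (La n (chain_poset (height Q1 + 1)) Q1).
Local Notation La2 n := (La n (chain_poset (height Q2 + 1)) Q2).

(** For active [R], the sets below [R] live in the cube under its intersection and those above in
    the cube over its union; both families avoid the shorter chains, so the values of [La] in these
    dimensions apply. *)
Lemma copies_otimes_antichain r : 0 < r -> exists2 A : {set {set T}}, antichain A &
  copies (otimes r Q1 Q2) F <=
  \sum_(R : {set {set T}} | (R \subset A) && (#|R| == r))
     La1 #|\bigcap_(M in R) M| * La2 #|~: \bigcup_(M in R) M|.
Proof.
move=> r_gt0; exists (\bigcup_(R : {set {set T}} | active R) R); first exact: active_antichain.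
apply: leq_trans (copies_otimes_le _ _ _ _) _.
rewrite (bigID active) /= [X in _ + X]big1 ?addn0; last first.
  move=> R /andP[/andP[sRF _]]; rewrite /active sRF /= lt0n negbK; exact/eqP.
rewrite [X in _ <= X](bigID active) /=; apply: leq_trans (leq_addr _ _).
rewrite (eq_bigl (fun R : {set {set T}} => (R \subset \bigcup_(R : {set {set T}} | active R) R)
  && (#|R| == r) && active R)); last first.
  move=> R; case act: (active R); rewrite ?andbF // !andbT; case/andP: (act) => -> _.
  by rewrite (bigcup_sup R).
apply: leq_sum => R /andP[/andP[_ /eqP cR] /andP[sRF]]; rewrite muln_gt0 => /andP[c1 c2].
have R_neq0 : R != set0 by rewrite -cards_eq0 cR -lt0n.
apply: leq_mul.
  apply: (@leq_La_interval _ _ _ _ _ set0); first by rewrite disjoints_subset sub0set.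
    move=> A /strictly_belowP[_ ltA]; rewrite sub0set set0U.
    by apply/bigcapsP => M /ltA/proper_sub.
  exact: below_free.
apply: (@leq_La_interval _ _ _ _ _ (\bigcup_(M in R) M)).
- by rewrite disjoints_subset setCK.
- move=> A /strictly_aboveP[_ ltA]; rewrite setUCr subsetT andbT.
  by apply/bigcupsP => M /ltA/proper_sub.
- exact: above_free.
Qed.

End FreeFamily.

Local Notation La1 n := (La n (chain_poset (height Q1 + 1)) Q1).
Local Notation La2 n := (La n (chain_poset (height Q2 + 1)) Q2).

Lemma card_setC_ord n (M : {set 'I_n}) : #|~: M| = n - #|M|.
Proof. by rewrite cardsCs setCK card_ord. Qed.

(** Here [R] is a singleton, equal intersection and union make its term a function of the size of
    its member, and the weighted LYM inequality applies. *)
Lemma La_otimes1_le n :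
  La n (chain_poset (height Q1 + height Q2 + 2)) (otimes 1 Q1 Q2) <=
  \max_(j < n.+1) ('C(n, j) * La1 j * La2 (n - j)).
Proof.
apply/bigmax_leqP => F F_free.
have [A acA] := copies_otimes_antichain F_free (ltn0Sn 0).
move/leq_trans; apply.
rewrite (eq_bigl (mem [set [set M] | M in A])); last first.
  move=> R /=; apply/andP/imsetP => [[sRA /cards1P[M eR]]|[M MA ->]].
    by exists M => //; rewrite -sub1set -eR.
  by rewrite sub1set MA cards1.
rewrite big_imset /=; last by move=> M N _ _; apply: set1_inj.
under eq_bigr => M _ do rewrite !big_set1 card_setC_ord.
apply: (LYM_weighted (f := fun k => La1 k * La2 (n - k)) acA) => k le_kn.
rewrite mulnA; exact: (@leq_bigmax _ (fun j : 'I_n.+1 => 'C(n, j) * La1 j * La2 (n - j))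
  (Ordinal (le_kn : k < n.+1))).
Qed.

End OtimesUpper.

(** * Spanning tuples of sets *)

Section Counting.

Lemma sum_sqr_le (K : finType) (a : K -> nat) :
  (\sum_k a k) ^ 2 <= #|K| * \sum_k a k ^ 2.
Proof.
rewrite -(leq_pmul2l (isT : 0 < 2)) -mulnn big_distrlr /= mulnA [2 * #|K|]mulnC -mulnA.
have -> : #|K| * (2 * \sum_k a k ^ 2) = \sum_(k : K) \sum_(l : K) (a k ^ 2 + a l ^ 2).
  under [RHS]eq_bigr => k _ do rewrite big_split /= sum_nat_const.
  by rewrite big_split /= sum_nat_const -big_distrr /= mul2n -addnn mulnDr.
rewrite big_distrr; apply: leq_sum => k _; rewrite big_distrr; apply: leq_sum => l _.
exact: nat_Cauchy.
Qed.

(** Cauchy-Schwarz for the fibre sizes of [f], whose squares count the colliding pairs. *)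
Lemma card_collisions (S K : finType) (A : {set S}) (f : S -> K) :
  #|A| ^ 2 <= #|K| * #|[set p : S * S | [&& p.1 \in A, p.2 \in A & f p.1 == f p.2]]|.
Proof.
have -> : #|A| = \sum_k #|[set x in A | f x == k]|.
  rewrite -sum1_card (partition_big f predT) //=; apply: eq_bigr => k _.
  by rewrite -sum1_card; apply: eq_bigl => x; rewrite inE.
apply: leq_trans (sum_sqr_le _) _; rewrite leq_mul2l; apply/orP; right.
rewrite -[X in _ <= X]sum1_card (partition_big (fun p => f p.1) predT) //=.
apply/eq_leq/eq_bigr => k _; rewrite -mulnn -cardsX -sum1_card.
apply: eq_bigl => p; rewrite !inE; case: (p.1 \in A); case: (p.2 \in A); rewrite ?andbF //=.
by rewrite andbC; apply/andP/andP => -[/eqP-> /eqP->].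
Qed.

Lemma exists_subset_card (T : finType) (A B : {set T}) r :
    A \subset B -> #|A| <= r <= #|B| ->
  exists C : {set T}, [/\ A \subset C, C \subset B & #|C| = r].
Proof.
move=> sAB /andP[]; elim: r => [|r IHr].
  by rewrite leqn0 => /eqP A0 _; exists A; split.
rewrite leq_eqVlt => /orP[/eqP<-|ltAr] le_rB; first by exists A.
have [C [sAC sCB cC]] := IHr ltAr (ltnW le_rB).
have /subsetPn[x xB xC] : ~~ (B \subset C).
  by apply/negP => /subset_leq_card; rewrite cC leqNgt le_rB.
exists (x |: C); split; last by rewrite cardsU1 xC cC.
  exact: subset_trans sAC (subsetUr _ _).
by rewrite subUset sub1set xB.
Qed.

Lemma card_le_surj (S S' : finType) (A : {set S}) (B : {set S'}) (g : S' -> S) :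
  (forall a, a \in A -> exists2 b, b \in B & a = g b) -> #|A| <= #|B|.
Proof.
move=> gB; apply: leq_trans (leq_imset_card g B).
by apply: subset_leq_card; apply/subsetP => a /gB[b bB ->]; apply: imset_f.
Qed.

End Counting.

Section Columns.
Variable r : nat.
Hypothesis r_gt0 : 0 < r.

(* A tuple of r sets with empty intersection and full union is recorded by its
   columns: [w x] is the set of indices of the members containing [x]. *)
Definition good_columns : {set {set 'I_r}} := [set S | (S != set0) && (S != setT)].
Definition column_tuples m : {set {ffun 'I_m -> {set 'I_r}}} :=
  [set w in ffun_on (mem good_columns)].
(** The size of the [i]-th member of the tuple. Tuples are ordered and their members may
    coincide. *)
Definition profile m (w : {ffun 'I_m -> {set 'I_r}}) i := \sum_x (i \in w x : nat).
Definition level_tuples m h := [set w in column_tuples m | [forall i, profile w i == h]].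

Lemma column_tuplesP m (w : {ffun 'I_m -> {set 'I_r}}) :
  reflect (forall x, w x != set0 /\ w x != setT) (w \in column_tuples m).
Proof.
rewrite inE; apply: (iffP ffun_onP) => good x; have := good x; rewrite !inE.
  by move/andP.
by move=> [-> ->].
Qed.

Lemma card_good_columns : #|good_columns| = 2 ^ r - 2.
Proof.
have -> : good_columns = ~: [set set0; setT] by apply/setP => S; rewrite !inE negb_or.
rewrite cardsCs setCK -cardsT -powersetT card_powerset cardsT card_ord cards2 (_ : set0 != setT) //.
by apply/eqP => /setP /(_ (Ordinal r_gt0)); rewrite !inE.
Qed.

Lemma card_column_tuples m : #|column_tuples m| = (2 ^ r - 2) ^ m.
Proof. by rewrite cardsE card_ffun_on card_good_columns card_ord. Qed.

Lemma profileE m (w : {ffun 'I_m -> {set 'I_r}}) i : profile w i = #|[set x | i \in w x]|.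
Proof. by rewrite -sum1dep_card big_mkcond /=; apply: eq_bigr => x _; case: (i \in w x). Qed.

Lemma profile_le m (w : {ffun 'I_m -> {set 'I_r}}) i : profile w i <= m.
Proof. by rewrite profileE -[leqRHS]card_ord max_card. Qed.

Lemma level_tuplesP m h (w : {ffun 'I_m -> {set 'I_r}}) :
  reflect (w \in column_tuples m /\ forall i, profile w i = h) (w \in level_tuples m h).
Proof.
rewrite [X in reflect _ X]in_set; apply: (iffP andP) => -[wT prof_w]; split=> //.
  by move=> i; apply/eqP; apply: (forallP prof_w).
by apply/forallP => i; apply/eqP.
Qed.


(* Pairs of tuples on two halves with the same profile: complementing the second
   half makes every member of the joint tuple have size [h]. *)
Lemma column_tuples_even h :
  (2 ^ r - 2) ^ (h + h) <= h.+1 ^ r * #|level_tuples (h + h) h|.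
Proof.
(* A profile on [h] points has entries at most [h], so [inord] loses nothing; the [h.+1 ^ r]
   possible profiles give the loss factor. *)
pose f (w : {ffun 'I_h -> {set 'I_r}}) : {ffun 'I_r -> 'I_h.+1} := [ffun i => inord (profile w i)].
have := card_collisions (column_tuples h) f.
rewrite card_column_tuples -expnM mulnC mul2n -addnn card_ffun !card_ord.
move/leq_trans; apply; rewrite leq_mul2l; apply/orP; right.
pose join (p : {ffun 'I_h -> {set 'I_r}} * {ffun 'I_h -> {set 'I_r}}) :
    {ffun 'I_(h + h) -> {set 'I_r}} :=
  [ffun x : 'I_(h + h) => match split x with inl y => p.1 y | inr y => ~: p.2 y end].
have joinl p y : join p (lshift h y) = p.1 y.
  by rewrite ffunE -[lshift h y]/(unsplit (inl y)) unsplitK.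
have joinr p y : join p (rshift h y) = ~: p.2 y.
  by rewrite ffunE -[rshift h y]/(unsplit (inr y)) unsplitK.
rewrite -(card_imset _ (f := join)); last first.
  move=> [u v] [u' v'] /ffunP eq_join; congr (_, _); apply/ffunP => y.
    by have := eq_join (lshift h y); rewrite !joinl.
  by have := eq_join (rshift h y); rewrite !joinr => /setC_inj.
apply: subset_leq_card; apply/subsetP => _ /imsetP[p + ->].
rewrite inE => /and3P[/column_tuplesP good1 /column_tuplesP good2 /eqP eqf].
apply/level_tuplesP; split=> [|i].
  apply/column_tuplesP => x; rewrite ffunE; case: (split x) => y; first exact: good1.
  have [neq0 neqT] := good2 y.
  split; [apply: contraNneq neqT|apply: contraNneq neq0] => eqC;
    by rewrite -[p.2 y]setCK eqC ?setC0 ?setCT.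
rewrite /profile big_split_ord /=.
under eq_bigr => y _ do rewrite joinl.
under [X in _ + X]eq_bigr => y _ do rewrite joinr inE.
have -> : \sum_(y < h) (i \in p.1 y : nat) = \sum_(y < h) (i \in p.2 y : nat).
  have := congr1 (fun g : {ffun 'I_r -> 'I_h.+1} => nat_of_ord (g i)) eqf.
  by rewrite /= !ffunE !inordK // ltnS profile_le.
rewrite -big_split /= -[RHS]card_ord -sum1_card; apply: eq_bigr => y _.
by case: (i \in p.2 y).
Qed.

(** An index of a column with at least two indices is moved to the new point, which keeps all sizes.
    Merging the new column back into the column of [y] inverts the move, and the choice of [y] costs
    the factor [h + h]. *)
Lemma level_tuples_odd h : 0 < h -> 2 < r ->
  #|level_tuples (h + h) h| <= (h + h) * #|level_tuples (h + h).+1 h|.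
Proof.
clear r_gt0 => h_gt0 r_gt2; rewrite -[X in X * _]card_ord -cardsT -cardsX.
pose g (p : 'I_(h + h) * {ffun 'I_(h + h).+1 -> {set 'I_r}}) :
    {ffun 'I_(h + h) -> {set 'I_r}} :=
  [ffun z => if z == p.1 then p.2 (lift ord0 z) :|: p.2 ord0 else p.2 (lift ord0 z)].
apply: (@card_le_surj _ _ _ _ g) => w /level_tuplesP[/column_tuplesP good prof_w].
(* If every column had at most one index, the sizes would add up to at most [h + h], which is less
   than [r * h]. *)
have [y gt1_y] : exists y, 1 < #|w y|.
  apply/existsP; rewrite -[X in is_true X]negbK negb_exists.
  apply/negP => /forallP le1.
  have: \sum_y #|w y| = r * h.
    transitivity (\sum_y \sum_(i : 'I_r) (i \in w y : nat)).
      apply: eq_bigr => y _; rewrite -sum1_card big_mkcond /=.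
      by apply: eq_bigr => i _; case: (i \in w y).
    rewrite exchange_big /=; under eq_bigr => i _ do rewrite -/(profile w i) prof_w.
    by rewrite sum_nat_const card_ord.
  apply/eqP; rewrite neq_ltn; apply/orP; left.
  apply: (@leq_ltn_trans (h + h)); last by nia.
  rewrite -[leqRHS]card_ord -sum1_card; apply: leq_sum => y _.
  by have := le1 y; rewrite -leqNgt.
have [s sw] : exists s, s \in w y by apply/card_gt0P/ltnW.
pose w' := [ffun x => if unlift ord0 x is Some z then
  (if z == y then w y :\ s else w z) else [set s]] : {ffun 'I_(h + h).+1 -> {set 'I_r}}.
have w'0 : w' ord0 = [set s] by rewrite ffunE unlift_none.
have w'S z : w' (lift ord0 z) = if z == y then w y :\ s else w z by rewrite ffunE liftK.
exists (y, w'); last first.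
  apply/ffunP => z; rewrite ffunE /= w'S; case: (z =P y) => // ->.
  by rewrite w'0 setUC setD1K.
rewrite in_setX in_setT /=; apply/level_tuplesP; split=> [|i].
  have set_neqT (S : {set 'I_r}) : #|S| < r -> S != setT.
    by apply: contraTneq => ->; rewrite cardsT card_ord ltnn.
  apply/column_tuplesP => x; case: (unliftP ord0 x) => [z|] ->; last first.
    rewrite w'0; split; first by rewrite -card_gt0 cards1.
    by apply: set_neqT; rewrite cards1 ltnW.
  rewrite w'S; case: (z =P y) => _; last exact: good.
  have cw := cardsD1 s (w y); rewrite sw in cw.
  split; first by rewrite -card_gt0; move: gt1_y; rewrite cw add1n ltnS.
  apply: set_neqT; have := max_card (mem (w y)); rewrite card_ord; apply: leq_trans.
  by rewrite cw.
rewrite /profile big_ord_recl w'0 -[RHS](prof_w i) /profile [RHS](bigD1 y) //=.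
under eq_bigr => z _ do rewrite w'S.
rewrite (bigD1 y) //= eqxx addnA; congr (_ + _).
  by rewrite !inE; case: eqP => // ->; rewrite sw.
by apply: eq_bigr => z /negPf->.
Qed.

(** Transposition of the incidence matrix between points and members. *)
Definition rows m (w : {ffun 'I_m -> {set 'I_r}}) : {ffun 'I_r -> {set 'I_m}} :=
  [ffun i => [set x | i \in w x]].
Definition columns m (t : {ffun 'I_r -> {set 'I_m}}) : {ffun 'I_m -> {set 'I_r}} :=
  [ffun x => [set i | x \in t i]].

Lemma rowsK m : cancel (@rows m) (@columns m).
Proof. by move=> w; apply/ffunP => x; apply/setP => i; rewrite !(ffunE, inE). Qed.

Lemma columnsK m : cancel (@columns m) (@rows m).
Proof. by move=> t; apply/ffunP => i; apply/setP => x; rewrite !(ffunE, inE). Qed.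

Definition spanning_sets m (F : {set {set 'I_m}}) := [set G : {set {set 'I_m}} |
  [&& G \subset F, #|G| == r, \bigcap_(A in G) A == set0 & \bigcup_(A in G) A == setT]].

Lemma gammaE m (F : {set {set 'I_m}}) : gamma r F = #|spanning_sets F|.
Proof. by []. Qed.

(** Members may coincide, so their set is first enlarged to [r] sets of the level; this keeps the
    empty intersection and full union. At most [r ^ r] tuples take their members from a given
    [r]-set. *)
Lemma level_tuples_gamma m h : r <= 'C(m, h) ->
  #|level_tuples m h| <= r ^ r * gamma r (full_level m h).
Proof.
move=> le_r; rewrite gammaE.
pose B := [set p : {set {set 'I_m}} * {ffun 'I_r -> {set 'I_m}} |
  (p.1 \in spanning_sets (full_level m h)) && (p.2 \in ffun_on (mem p.1))].
have -> : r ^ r * #|spanning_sets (full_level m h)| = #|B|.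
  rewrite -[RHS]sum1dep_card -(pair_big_dep (mem (spanning_sets (full_level m h)))
    (fun G (t : {ffun 'I_r -> {set 'I_m}}) => t \in ffun_on (mem G)) (fun _ _ => 1)) /=.
  rewrite mulnC -sum_nat_const; apply: eq_bigr => G.
  rewrite inE => /and4P[_ /eqP cG _ _].
  by rewrite sum1_card card_ffun_on card_ord cG.
apply: (@card_le_surj _ _ _ _ (fun p => columns p.2)) => w.
case/level_tuplesP => /column_tuplesP good prof_w.
have [G [sG sGl cG]] : exists G : {set {set 'I_m}},
    [/\ [set rows w i | i : 'I_r] \subset G, G \subset full_level m h & #|G| = r].
  apply: exists_subset_card.
    apply/subsetP => _ /imsetP[i _ ->]; rewrite inE ffunE -profileE prof_w //.
  by rewrite card_full_level le_r andbT -[leqRHS]card_ord leq_imset_card.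
have rG i : rows w i \in G by apply: (subsetP sG); apply: imset_f.
exists (G, rows w); last by rewrite rowsK.
rewrite inE /=; apply/andP; split; last by apply/ffun_onP.
rewrite inE sGl cG eqxx /=; apply/andP; split.
  apply/eqP/setP => x; rewrite inE; apply/negP => /bigcapP cap.
  have [_ /eqP[]] := good x; apply/setP => i; rewrite inE.
  by have := cap _ (rG i); rewrite ffunE inE.
apply/eqP/setP => x; rewrite inE; apply/bigcupP.
have [/set0Pn[i iw] _] := good x; exists (rows w i) => //.
by rewrite ffunE inE.
Qed.

(** Each set counted by [gamma] has [r] factorial orderings, an ordering determines its set, and the
    spanning condition makes every column good. *)
Lemma gamma_column_tuples m (F : {set {set 'I_m}}) : r`! * gamma r F <= (2 ^ r - 2) ^ m.
Proof.
rewrite gammaE -card_column_tuples.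
pose B := [set p : {set {set 'I_m}} * {ffun 'I_r -> {set 'I_m}} |
  (p.1 \in spanning_sets F) && (p.2 \in [set t in ffun_on (mem p.1) | injectiveb t])].
have imB p : p \in B -> p.1 = [set p.2 i | i : 'I_r].
  rewrite !inE => /and3P[/and4P[_ /eqP cG _ _] /ffun_onP tG /injectiveP inj_t].
  apply/eqP; rewrite eq_sym eqEcard card_imset // card_ord cG leqnn andbT.
  by apply/subsetP => _ /imsetP[i _ ->]; apply: tG.
have -> : r`! * #|spanning_sets F| = #|B|.
  rewrite -[RHS]sum1dep_card -(pair_big_dep (mem (spanning_sets F))
    (fun G (t : {ffun 'I_r -> {set 'I_m}}) => t \in [set t in ffun_on (mem G) | injectiveb t])
    (fun _ _ => 1)) /=.
  rewrite mulnC -sum_nat_const; apply: eq_bigr => G.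
  rewrite inE => /and4P[_ /eqP cG _ _].
  by rewrite sum1_card card_inj_ffuns_on card_ord cG ffactnn.
rewrite -(@card_in_imset _ _ (fun p => columns p.2)); last first.
  move=> [G t] [G' t'] /imB /= -> /imB /= -> eqc.
  by rewrite (can_inj (@columnsK m) eqc).
apply: subset_leq_card; apply/subsetP => _ /imsetP[[G t] Bp ->] /=.
have /= eG := imB _ Bp; move: Bp; rewrite !inE /= => /and3P[/and4P[_ _ /eqP cap /eqP cup] _ _].
apply/ffun_onP => x; rewrite !inE ffunE; apply/andP; split.
  have : x \in [set: 'I_m] by rewrite in_setT.
  rewrite -cup eG => /bigcupP[_ /imsetP[i _ ->] xi].
  by apply/set0Pn; exists i; rewrite inE.
apply: contraFneq (in_set0 x) => colT; rewrite -cap eG; apply/bigcapP => _ /imsetP[i _ ->].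
by have := in_setT i; rewrite -colT inE.
Qed.

Lemma gamma_neq0 m (F : {set {set 'I_m}}) : 0 < gamma r F -> r <= #|F|.
Proof.
by case/card_gt0P=> G; rewrite inE => /and4P[/subset_leq_card + /eqP <- _ _].
Qed.

End Columns.

(** * Elementary bounds on powers and factorials *)

Section Powers.

(** Bernoulli's inequality for the powers of [1 - 1 / n.+1], with denominators cleared. *)
Lemma succ_expn_bernoulli n k : k <= n.+1 -> n.+1 ^ k * (n.+1 - k) <= n ^ k * n.+1.
Proof.
elim: k => [|k IHk] le_k; first by rewrite subn0.
have := IHk (ltnW le_k); rewrite !expnSr; set a := n.+1 ^ k; set b := n ^ k => IH.
apply: (@leq_trans (n * (a * (n.+1 - k)))).
  rewrite [n * _]mulnCA -[X in X <= _]mulnA leq_mul2l; apply/orP; right.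
  have -> : n.+1 - k = (n.+1 - k.+1).+1 by lia.
  by nia.
by rewrite -mulnA [b * _]mulnCA leq_mul2l IH orbT.
Qed.

Lemma succ_expn_le2 n k : 2 * k <= n.+1 -> n.+1 ^ k <= 2 * n ^ k.
Proof.
move=> le_k; have := @succ_expn_bernoulli n k; set a := _ ^ k; set b := _ ^ k.
by move=> /(_ ltac:(lia)) le_ab; nia.
Qed.

Lemma succ_expn_le4 n : n.+1 ^ n <= 4 * n ^ n.
Proof.
(* Each half of the exponent is at most [n.+1 / 2] and costs a factor 2. *)
rewrite -[n in _ ^ n](subnK (leq_div n 2)) -[X in 4 * _ ^ X](subnK (leq_div n 2)).
rewrite !expnD -[4]/(2 * 2) mulnACA.
by apply: leq_mul; apply: succ_expn_le2; lia.
Qed.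

Lemma expn_self_fact r : 0 < r -> r ^ r <= 4 ^ r.-1 * r`!.
Proof.
elim: r => // -[|r] IHr _ //; have := IHr isT.
rewrite [r.+2 ^ _]expnS [r.+2`!]factS /= [4 ^ r.+1]expnS; move: (r.+1`!) => f IH.
apply: (@leq_trans (r.+2 * (4 * r.+1 ^ r.+1))); first by rewrite leq_mul2l succ_expn_le4.
by rewrite -mulnA ![_ * (r.+2 * _)]mulnCA leq_mul2l leq_mul2l IH.
Qed.

End Powers.

(** * Antichains compared with the middle level *)

Section GammaBounds.
Variable r : nat.

Lemma column_tuples_even_le h : 0 < r -> r <= 'C(h + h, h) ->
  (2 ^ r - 2) ^ (h + h) <= h.+1 ^ r * (r ^ r * gamma r (full_level (h + h) h)).
Proof.
move=> r_gt0 le_r; apply: leq_trans (column_tuples_even r_gt0 h) _.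
by rewrite leq_mul2l level_tuples_gamma ?orbT.
Qed.

Lemma column_tuples_odd_le h : 0 < h -> 2 < r -> r <= 'C((h + h).+1, h) ->
  (2 ^ r - 2) ^ (h + h).+1 <=
  (2 ^ r - 2) * (h.+1 ^ r * ((h + h) * (r ^ r * gamma r (full_level (h + h).+1 h)))).
Proof.
move=> h_gt0 r_gt2 le_r; rewrite expnS leq_mul2l; apply/orP; right.
apply: leq_trans (column_tuples_even (ltnW (ltnW r_gt2)) h) _; rewrite leq_mul2l; apply/orP; right.
apply: leq_trans (level_tuples_odd h_gt0 r_gt2) _; rewrite leq_mul2l; apply/orP; right.
exact: level_tuples_gamma.
Qed.

(** By Sperner, an antichain with [r] members forces a middle level of at least [r] sets, as passing
    from tuples to sets requires. *)
Lemma gamma_antichain_le_bin m (F : {set {set 'I_m}}) : antichain F ->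
  0 < gamma r F -> r <= 'C(m, m %/ 2).
Proof. by move=> /sperner le_F /gamma_neq0 /leq_trans->. Qed.

Lemma half_double h : (h + h) %/ 2 = h. Proof. by lia. Qed.
Lemma half_double_succ h : (h + h).+1 %/ 2 = h. Proof. by lia. Qed.

(* Cancels [r`!] against the [r ^ r] lost when passing from tuples to sets. *)
Lemma cancel_fact c g g' : 0 < r -> r`! * g <= c * (r ^ r * g') -> g <= c * (4 ^ r.-1 * g').
Proof.
move=> r_gt0 le_g; rewrite -(leq_pmul2l (fact_gt0 r)); apply: leq_trans le_g _.
rewrite [r`! * _]mulnCA leq_mul2l; apply/orP; right.
by rewrite mulnA leq_mul2r mulnC expn_self_fact ?orbT.
Qed.

Lemma gamma_antichain_even h (F : {set {set 'I_(h + h)}}) : 1 < r -> 0 < h -> antichain F ->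
  gamma r F <= (h + h) ^ (2 * r) * gamma r (full_level (h + h) h).
Proof.
move=> r_gt1 h_gt0 acF; have [->//|g_gt0] := posnP (gamma r F).
have r_gt0 : 0 < r by apply: ltnW.
have := gamma_antichain_le_bin acF g_gt0; rewrite half_double => le_r.
have le_g := leq_trans (gamma_column_tuples r_gt0 F) (column_tuples_even_le r_gt0 le_r).
apply: leq_trans (cancel_fact r_gt0 le_g) _.
rewrite mulnA leq_mul2r; apply/orP; right; rewrite expnM.
case: h h_gt0 le_r {F acF g_gt0 le_g} => [|[|h]] // _ le_r.
  (* For [h = 1] the middle level has two sets, so [r = 2] and both sides equal 16. *)
  by have -> : r = 2 by move: le_r r_gt1; rewrite -[_ + _]/2 bin1; lia.
apply: (@leq_trans (h.+3 ^ r * 4 ^ r)).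
  by rewrite leq_mul2l leq_exp2l ?leq_pred ?orbT.
by rewrite -expnMn leq_exp2r //; nia.
Qed.

Lemma gamma_antichain_odd h (F : {set {set 'I_(h + h).+1}}) : 2 < r -> 0 < h -> antichain F ->
  gamma r F <= (h + h).+1 ^ (2 * r) * gamma r (full_level (h + h).+1 h).
Proof.
move=> r_gt2 h_gt0 acF; have [->//|g_gt0] := posnP (gamma r F).
have r_gt0 : 0 < r by apply: ltnW (ltnW _).
have := gamma_antichain_le_bin acF g_gt0; rewrite half_double_succ => le_r.
have le_g := leq_trans (gamma_column_tuples r_gt0 F) (column_tuples_odd_le h_gt0 r_gt2 le_r).
(* The general estimate needs [h >= 2]. In dimension 3 the middle level has three sets, so [r = 3]
   and [F] has a single [r]-subset. *)
case: (ltnP 1 h) => [h_gt1|h_le1]; last first.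
  have h1 : h = 1 by lia.
  subst h; have r3 : r = 3 by move: le_r r_gt2; rewrite -[(_ + _).+1]/3 bin1; lia.
  have gl_gt0 : 0 < gamma r (full_level (1 + 1).+1 1).
    rewrite lt0n; apply: contraTneq le_g => ->.
    by rewrite !muln0 leqn0 muln_eq0 negb_or -!lt0n fact_gt0.
  apply: (@leq_trans 1); last by rewrite muln_gt0 expn_gt0.
  have cF : #|F| = r.
    apply/eqP; rewrite eqn_leq gamma_neq0 // andbT r3.
    by have := sperner acF; rewrite -[(_ + _).+1]/3 bin1.
  apply: (@leq_trans 'C(#|F|, r)); last by rewrite cF binn.
  rewrite -cards_draws; apply: subset_leq_card.
  by apply/subsetP => G; rewrite !inE => /and4P[-> ->].
rewrite [_ * (h.+1 ^ r * _)]mulnA [_ * ((h + h) * _)]mulnA in le_g.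
apply: leq_trans (cancel_fact r_gt0 le_g) _.
rewrite mulnA leq_mul2r; apply/orP; right.
case: (r) r_gt0 => // q _ /=.
(* Of the [q.+1] squares, [q] pay for the factors with exponent [q], since
   [8 * h.+1 <= (h + h).+1 ^ 2] for [h >= 2]; the last one pays for [4 * (h * h.+1)]. *)
apply: (@leq_trans (((h + h).+1 ^ 2) ^ q * (h + h).+1 ^ 2)); last by rewrite -expnSr -expnM.
apply: (@leq_trans ((8 * h.+1) ^ q * (4 * (h * h.+1)))); last first.
  by apply: leq_mul; [case: q => // q; rewrite leq_exp2r //; nia | nia].
rewrite -[8]/(2 * 4) !expnMn.
have le2 : 2 ^ q.+1 - 2 <= 2 ^ q * 2 by rewrite -expnSr leq_subr.
rewrite [h.+1 ^ q.+1]expnSr; move: (2 ^ q.+1 - 2) (2 ^ q) (4 ^ q) (h.+1 ^ q) le2 => a b c d le_ab.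
apply: (@leq_trans (b * 2 * (d * h.+1) * (h + h) * c)).
  by rewrite leq_mul2r; apply/orP; right; rewrite !leq_mul.
by apply: eq_leq; lia.
Qed.

Lemma gamma_antichain m (F : {set {set 'I_m}}) : 1 < r -> (2 < r) || ~~ odd m -> antichain F ->
  gamma r F <= m ^ (2 * r) * gamma r (full_level m (m %/ 2)).
Proof.
move=> r_gt1 r_odd acF; have [m_le1|m_gt1] := leqP m 1.
  have [->//|/(gamma_antichain_le_bin acF)] := posnP (gamma r F).
  have -> : m %/ 2 = 0 by lia.
  by rewrite bin0 leqNgt r_gt1.
have h_gt0 : 0 < m %/ 2 by lia.
have em : m = (if odd m then (m %/ 2 + m %/ 2).+1 else m %/ 2 + m %/ 2) by case: ifP; lia.
move: (m %/ 2) h_gt0 em => h h_gt0; case: ifP r_odd => odd_m r_odd em; move: acF; subst m.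
  by apply: gamma_antichain_odd; rewrite // orbF in r_odd.
exact: gamma_antichain_even.
Qed.

(** The middle level attains the full exponential rate [2 ^ r - 2] up to a polynomial factor. This
    allows [gamma] to be replaced by a power and recovered later. *)
Lemma column_tuples_le_gamma m : 2 < r -> r <= m ->
  (2 ^ r - 2) ^ m <= 2 ^ r * r ^ r * (m ^ r.+1 * gamma r (full_level m (m %/ 2))).
Proof.
move=> r_gt2 le_rm; have r_gt0 : 0 < r by apply: ltnW (ltnW _).
have le_rC : r <= 'C(m, m %/ 2) by apply: leq_trans le_rm (leq_central_bin m).
have h_gt0 : 0 < m %/ 2 by lia.
have em : m = (if odd m then (m %/ 2 + m %/ 2).+1 else m %/ 2 + m %/ 2) by case: ifP; lia.
move: (m %/ 2) h_gt0 em le_rC => h h_gt0; case: ifP => odd_m em; subst m => le_rC.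
  apply: leq_trans (column_tuples_odd_le h_gt0 r_gt2 le_rC) _.
  move: (gamma _ _) => g; rewrite [(_ + _).+1 ^ _]expnSr.
  have le_h : h.+1 ^ r <= (h + h).+1 ^ r by rewrite leq_exp2r //; lia.
  have le_2 : 2 ^ r - 2 <= 2 ^ r by apply: leq_subr.
  rewrite -!mulnA; apply: leq_mul => //.
  rewrite [r ^ r * (_ * _)]mulnCA; apply: leq_mul => //.
  by rewrite [r ^ r * (_ * _)]mulnCA leq_mul2r leqnSn orbT.
apply: leq_trans (column_tuples_even_le r_gt0 le_rC) _.
have le_h : h.+1 ^ r <= (h + h) ^ r by rewrite leq_exp2r //; lia.
rewrite mulnCA -!mulnA; apply: leq_trans (leq_pmull _ (expn_gt0 2 r)).
rewrite leq_mul2l; apply/orP; right; rewrite leq_mul2r; apply/orP; right.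
by apply: leq_trans le_h _; rewrite leq_exp2l //; lia.
Qed.

End GammaBounds.

(** Two sets of size [h] cannot cover [h + h + 1] points, so for pairs the comparison is with the
    cube of one dimension less. *)
Lemma gamma_pair_odd h (F : {set {set 'I_(h + h).+1}}) : antichain F ->
  gamma 2 F <= 4 * h.+1 ^ 2 * gamma 2 (full_level (h + h) h).
Proof.
move=> acF; have [->//|g_gt0] := posnP (gamma 2 F).
have h_gt0 : 0 < h.
  have := gamma_antichain_le_bin acF g_gt0.
  by case: h F acF g_gt0 => [|//] F _ _; rewrite bin0.
have le_2 : 2 <= 'C(h + h, h).
  by have := leq_central_bin (h + h); rewrite half_double; lia.
have := gamma_column_tuples (isT : 0 < 2) F; rewrite expnS.
have := @column_tuples_even_le 2 h isT le_2.
rewrite (_ : 2 ^ 2 = 4) // (_ : 2`! = 2) //.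
by move: (_ ^ (h + h)) (h.+1 ^ 2) => a b; lia.
Qed.

(** * The upper bound for r at least 2 *)

Lemma imset_subset_inj (S T : finType) (f : S -> T) (A B : {set S}) : injective f ->
  ([set f x | x in A] \subset [set f x | x in B]) = (A \subset B).
Proof.
move=> inj_f; apply/idP/idP => [sAB|]; last exact: imsetS.
apply/subsetP => x xA; have : f x \in [set f x | x in B].
  by apply: (subsetP sAB); apply: imset_f.
by case/imsetP => y yB /inj_f->.
Qed.

Lemma La_leS (dP dQ : Order.disp_t) (P : finPOrderType dP) (Q : finPOrderType dQ) n :
  La n P Q <= La n.+1 P Q.
Proof.
apply/bigmax_leqP => F F_free.
pose g (A : {set 'I_n}) := [set lift ord0 x | x in A].
have gS (A B : {set 'I_n}) : (g A \subset g B) = (A \subset B).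
  exact: imset_subset_inj (@lift_inj _ _).
rewrite -(copies_embedding Q gS); apply: leq_La.
by rewrite /poset_free (copies_embedding P gS).
Qed.

Lemma La_mono (dP dQ : Order.disp_t) (P : finPOrderType dP) (Q : finPOrderType dQ) :
  {homo (fun n => La n P Q) : m n / m <= n}.
Proof. by apply: homo_leq => [//|??? |n]; [exact: leq_trans|exact: La_leS]. Qed.

Section SpanningIntervals.
Variables (T : finType) (I D : {set T}).
Hypothesis disjID : [disjoint I & D].
Local Notation g := (interval_embedding I (D := D)).

(** Every such [R] lies in the interval from [I] to [I :|: D], so the interval embedding carries
    spanning sets of the cube onto these [R]. *)
Lemma card_spanning_interval r (A : {set {set T}}) : 0 < r ->
  #|[set R : {set {set T}} | [&& R \subset A, #|R| == r,
      \bigcap_(M in R) M == I & \bigcup_(M in R) M == I :|: D]]| =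
  gamma r (g @^-1: A).
Proof.
move=> r_gt0; have gS := interval_embeddingS disjID.
have g_inj : injective g := embedding_inj gS.
have mem_g (x : 'I_#|D|) (B : {set 'I_#|D|}) : (enum_val x \in g B) = (x \in B).
  rewrite inE; have -> : (enum_val x \in I) = false.
    by apply/negP => xI; have := disjointFr disjID xI; rewrite enum_valP.
  by apply/imsetP/idP => [[y yB /enum_val_inj->]|xB] //; exists x.
rewrite gammaE -(card_imset _ (imset_inj g_inj)).
apply: eq_card => R; rewrite !inE; apply/and4P/imsetP.
  case=> sRA /eqP cR /eqP cap /eqP cup.
  have eR : [set g B | B in g @^-1: R] = R.
    apply: imset_preimset_embedding => M MR; apply: interval_embedding_surj.
      by rewrite -cap; apply: bigcap_inf.
    by rewrite -cup; apply: bigcup_sup.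
  exists (g @^-1: R) => //; rewrite inE; apply/and4P; split.
  - by apply/subsetP => B; rewrite !inE => /(subsetP sRA).
  - by rewrite -cR -eR card_imset // eR.
  - apply/eqP/setP => x; rewrite inE; apply/negP => /bigcapP capx.
    have : enum_val x \in \bigcap_(M in R) M.
      by apply/bigcapP => M; rewrite -eR => /imsetP[B BR ->]; rewrite mem_g capx.
    rewrite cap => xI.
    by have := disjointFr disjID xI; rewrite enum_valP.
  - apply/eqP/setP => x; rewrite inE; apply/bigcupP.
    have : enum_val x \in \bigcup_(M in R) M by rewrite cup inE enum_valP orbT.
    case/bigcupP => M; rewrite -eR => /imsetP[B BR ->]; rewrite mem_g => xB.
    by exists B; rewrite ?eR.
case=> G; rewrite inE => /and4P[/subsetP sG /eqP cG /eqP cap /eqP cup] ->.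
have [B0 B0G] : exists B, B \in G by apply/set0Pn; rewrite -cards_eq0 cG -lt0n.
split.
- by apply/subsetP => _ /imsetP[B /sG + ->]; rewrite inE.
- by rewrite card_imset // cG.
- apply/eqP/setP => y; apply/bigcapP/idP => [capy|yI M /imsetP[B _ ->]]; last by rewrite inE yI.
  have : y \in g B0 by apply: capy; apply: imset_f.
  rewrite inE => /orP[//|/imsetP[x _ ey]].
  have : x \in \bigcap_(B in G) B.
    apply/bigcapP => B BG; rewrite -mem_g -ey; apply: capy; exact: imset_f.
  by rewrite cap inE.
- apply/eqP/setP => y; apply/bigcupP/idP => [[M /imsetP[B _ ->]]|].
    by rewrite !inE => /orP[->//|/imsetP[x _ ->]]; rewrite enum_valP orbT.
  rewrite inE => /orP[yI|yD].
    by exists (g B0); rewrite ?imset_f // inE yI.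
  have : enum_rank_in yD y \in \bigcup_(B in G) B by rewrite cup inE.
  case/bigcupP => B BG; rewrite -mem_g enum_rankK_in // => yB.
  by exists (g B); rewrite ?imset_f.
Qed.

Lemma antichain_interval (A : {set {set T}}) : antichain A -> antichain (g @^-1: A).
Proof.
have gS := interval_embeddingS disjID.
by move=> acA M N; rewrite !inE => MA NA; rewrite -gS => /(acA _ _ MA NA)/(embedding_inj gS).
Qed.

End SpanningIntervals.

Section SizeSums.

Lemma sum_card_sets n (h : nat -> nat) :
  \sum_(J : {set 'I_n}) h #|J| = \sum_(j < n.+1) 'C(n, j) * h j.
Proof.
have lt_n (J : {set 'I_n}) : #|J| < n.+1 by rewrite ltnS -[leqRHS]card_ord max_card.
rewrite (partition_big (fun J => Ordinal (lt_n J)) predT) //=; apply: eq_bigr => j _.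
rewrite -card_full_level -sum_nat_const; apply: eq_big => J.
  by rewrite inE -val_eqE.
by move/eqP <-.
Qed.

Lemma sum_card_proper (T : finType) (J : {set T}) (h : nat -> nat) :
  \sum_(I : {set T} | I \proper J) h #|I| = \sum_(i < #|J|) 'C(#|J|, i) * h i.
Proof.
case cJ: #|J| => [|k].
  by rewrite big_ord0 big1 // => I /proper_card; rewrite cJ.
have inord_val (I : {set T}) : I \proper J -> @inord k #|I| = #|I| :> nat.
  by move/proper_card => lt_IJ; rewrite inordK // -cJ.
rewrite (partition_big (fun I : {set T} => @inord k #|I|) predT) //=.
apply: eq_bigr => i _.
have -> : 'C(k.+1, i) = #|[set A : {set T} | A \subset J & #|A| == i]| by rewrite cards_draws cJ.
rewrite -sum_nat_const; apply: eq_big => I.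
  rewrite inE; apply/andP/andP => [[IJ /eqP <-]|[sIJ /eqP cI]].
    by rewrite inord_val // proper_sub.
  have IJ : I \proper J by rewrite properEcard sIJ cI cJ ltn_ord.
  by split=> //; apply/eqP/val_inj; rewrite /= inord_val // cI.
by case/andP=> IJ /eqP <-; rewrite inord_val.
Qed.

End SizeSums.

Section OtimesUpperGamma.
Variables (d1 d2 : Order.disp_t).
Variables (Q1 : finPOrderType d1) (Q2 : finPOrderType d2).
Local Notation La1 n := (La n (chain_poset (height Q1 + 1)) Q1).
Local Notation La2 n := (La n (chain_poset (height Q2 + 1)) Q2).
Variables (r n : nat).
Hypotheses (r_gt1 : 1 < r) (n_gt0 : 0 < n).

Local Notation gamma_mid m := (gamma r (full_level m (m %/ 2))).

(** As [1 < r], the second branch is the case of [r = 2] and odd [m]. *)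
Definition gamma_bound m :=
  if (2 < r) || ~~ odd m then m ^ (2 * r) * gamma_mid m
  else 4 * (m %/ 2).+1 ^ 2 * gamma_mid m.-1.

Lemma gamma_antichain_bound m (F : {set {set 'I_m}}) : antichain F ->
  gamma r F <= gamma_bound m.
Proof.
rewrite /gamma_bound; case: ifP => [r_odd|/norP[]]; first exact: gamma_antichain.
rewrite -leqNgt negbK => r_le2 odd_m; have -> : r = 2 by apply/eqP; rewrite eqn_leq r_le2.
have -> : (m.-1) %/ 2 = m %/ 2 by lia.
have em : m = (m %/ 2 + m %/ 2).+1 by lia.
move: (m %/ 2) em => h em; subst m => acF.
exact: gamma_pair_odd.
Qed.

Local Notation value i j :=
  ('C(n, j) * 'C(j, i) * gamma_mid (j - i) * La1 i * La2 (n - j)).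
Local Notation max_value := (\max_(j < n.+1) \max_(i < j) value i j).

Lemma value_le i j : i < j <= n -> value i j <= max_value.
Proof.
case/andP=> lt_ij; rewrite -ltnS => lt_jn.
apply: leq_trans (@leq_bigmax _ (fun j : 'I_n.+1 => \max_(i < j) value i j) (Ordinal lt_jn)).
exact: (@leq_bigmax _ (fun i : 'I_j => value i j) (Ordinal lt_ij)).
Qed.

(** One unit moves from the middle part [j - i] of the trinomial coefficient to the part [n - j]. *)
Lemma mul_bin2_step i j : i < j <= n ->
  'C(n, j) * 'C(j, i) * (j - i) = 'C(n, j.-1) * 'C(j.-1, i) * (n - j.-1).
Proof.
case: j => // j /andP[le_ij lt_jn] /=.
have e1 := mul_bin_left n j; have e2 := mul_bin_down j.+1 i; rewrite /= in e2.
rewrite -[LHS]mulnA [_ * (j.+1 - i)]mulnC -e2 mulnA [_ * j.+1]mulnC e1.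
by rewrite -mulnA mulnC.
Qed.

(** For [r = 2] and [j - i] odd, [j] is replaced by [j.-1]: the trinomial coefficient loses a factor
    of at most [n], and [La2] is taken in a larger dimension. *)
Lemma gamma_bound_value i j : i < j <= n ->
  'C(n, j) * 'C(j, i) * (gamma_bound (j - i) * (La1 i * La2 (n - j))) <=
  n ^ (2 * r) * max_value.
Proof.
case/andP=> lt_ij le_jn; rewrite /gamma_bound; case: ifP => [_|/norP[]].
  apply: (@leq_trans (n ^ (2 * r) * value i j)); last first.
    by rewrite leq_mul2l value_le ?lt_ij ?orbT.
  rewrite -!mulnA mulnCA [X in X <= _]mulnCA.
  rewrite ['C(j, i) * (_ ^ _ * _)]mulnCA ['C(n, j) * (_ ^ _ * _)]mulnCA leq_mul2r.
  by rewrite leq_exp2r ?orbT //; lia.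
rewrite -leqNgt negbK => r_le2 odd_m.
have r2 : r = 2 by apply/eqP; rewrite eqn_leq r_le2.
(* For [j - i = 1] the shortened interval is a single set and contains no pair. *)
have [m_le1|m_gt1] := leqP (j - i) 1.
  have -> : gamma_mid (j - i).-1 = 0.
    have -> : (j - i).-1 = 0 by lia.
    have [//|/gamma_neq0] := posnP (gamma r (full_level 0 (0 %/ 2))).
    by rewrite card_full_level bin0 leqNgt r_gt1.
  by rewrite muln0 mul0n muln0.
have lt_ij' : i < j.-1 by lia.
have val_le := @value_le i j.-1 (introT andP (conj lt_ij' (leq_trans (leq_pred j) le_jn))).
have step := @mul_bin2_step i j (introT andP (conj lt_ij le_jn)).
have La2_le : La2 (n - j) <= La2 (n - j.-1) by apply: La_mono; lia.
have bin_le : 'C(n, j) * 'C(j, i) <= 'C(n, j.-1) * 'C(j.-1, i) * n.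
  apply: (@leq_trans ('C(n, j) * 'C(j, i) * (j - i))); first by rewrite leq_pmulr // subn_gt0.
  by rewrite step leq_mul2l leq_subr orbT.
rewrite (_ : (j - i).-1 = j.-1 - i); last by lia.
apply: (@leq_trans (4 * ((j - i) %/ 2).+1 ^ 2 * n * value i j.-1)).
  apply: (@leq_trans ('C(n, j.-1) * 'C(j.-1, i) * n *
      (4 * ((j - i) %/ 2).+1 ^ 2 * gamma_mid (j.-1 - i) * (La1 i * La2 (n - j.-1))))).
    by apply: leq_mul => //; rewrite !leq_mul.
  by apply: eq_leq; lia.
apply: leq_mul => //; rewrite r2 -[2 * 2]/(2 + 2) expnD.
have n_gt2 : 2 < n by lia.
(* The equality uses that [j - i] is odd; the product is then absorbed by [n.+1 ^ 2 * n <= n ^ 4]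
   for [n > 2]. *)
have -> : 4 * ((j - i) %/ 2).+1 ^ 2 = (j - i).+1 ^ 2 by nia.
apply: (@leq_trans (n.+1 ^ 2 * n)); last by nia.
by rewrite leq_mul2r leq_exp2r ?orbT //; lia.
Qed.

Lemma La_otimes_le :
  La n (chain_poset (height Q1 + height Q2 + 2)) (otimes r Q1 Q2) <=
  n ^ (2 * r + 2) * max_value.
Proof.
apply/bigmax_leqP => F F_free; have r_gt0 : 0 < r by apply: ltnW.
have [A acA] := copies_otimes_antichain F_free r_gt0.
move/leq_trans; apply.
pose y i j := gamma_bound (j - i) * (La1 i * La2 (n - j)).
(* The sets [R] are grouped by union [J] and intersection [I]; having two different members makes
   [I] a proper subset of [J]. *)
apply: (@leq_trans (\sum_(J : {set 'I_n}) \sum_(I : {set 'I_n} | I \proper J) y #|I| #|J|)).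
  rewrite (partition_big (fun R : {set {set 'I_n}} => \bigcup_(M in R) M) predT) //=.
  apply: leq_sum => J _.
  rewrite (partition_big (fun R : {set {set 'I_n}} => \bigcap_(M in R) M)
    (fun I => I \proper J)) /=; last first.
    move=> R /andP[/andP[_ /eqP cR] /eqP cup].
    have /card_gt1P[M [N [MR NR neqMN]]] : 1 < #|R| by rewrite cR.
    have capS K : K \in R -> \bigcap_(M in R) M \subset K by move=> KR; apply: bigcap_inf.
    have cupS K : K \in R -> K \subset J by rewrite -cup => KR; apply: bigcup_sup.
    rewrite properEneq (subset_trans (capS M MR) (cupS M MR)) andbT.
    apply: contraNneq neqMN => eq_cap.
    have eJ K : K \in R -> K = J.
      by move=> KR; apply/eqP; rewrite eqEsubset cupS // -{1}eq_cap capS.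
    by rewrite (eJ M MR) (eJ N NR).
  apply: leq_sum => I IJ.
  have disjID : [disjoint I & J :\: I].
    by rewrite disjoint_sym disjoints_subset setDE subsetIr.
  have eJ : I :|: (J :\: I) = J.
    apply/setP => x; rewrite !inE; case: (boolP (x \in I)) => //.
    by move/(subsetP (proper_sub IJ)) ->.
  apply: (@leq_trans (\sum_(R in [set R : {set {set 'I_n}} | [&& R \subset A, #|R| == r,
      \bigcap_(M in R) M == I & \bigcup_(M in R) M == J]]) La1 #|I| * La2 (n - #|J|))).
    apply/eq_leq/eq_big => R; rewrite ?inE; first by rewrite -!andbA; do !bool_congr.
    by case/andP=> /andP[_ /eqP->] /eqP->; rewrite card_setC_ord.
  have := card_spanning_interval disjID A r_gt0; rewrite eJ => cR.
  rewrite sum_nat_const cR leq_mul2r; apply/orP; right.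
  have -> : #|J| - #|I| = #|J :\: I| by rewrite cardsD (setIidPr (proper_sub IJ)).
  exact/gamma_antichain_bound/antichain_interval.
under eq_bigr => J _ do rewrite (sum_card_proper J (fun i => y i #|J|)).
rewrite (sum_card_sets n (fun j => \sum_(i < j) 'C(j, i) * y i j)).
apply: (@leq_trans (\sum_(j < n.+1) \sum_(i < j) n ^ (2 * r) * max_value)).
  apply: leq_sum => j _; rewrite big_distrr /=; apply: leq_sum => i _.
  rewrite mulnA; apply: gamma_bound_value.
  by rewrite ltn_ord -ltnS ltn_ord.
under eq_bigr => j _ do rewrite sum_nat_const card_ord.
rewrite -big_distrl /= expnD -mulnA mulnCA leq_mul2l; apply/orP; right.
rewrite leq_mul2r; apply/orP; right.
(* The number of pairs [i < j] is ['C(n.+1, 2)], at most [n ^ 2]: these are the two extra powers of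
   [n]. *)
rewrite -(big_mkord predT (fun j => j)) bin2_sum bin2 /=.
by rewrite leq_half_double; nia.
Qed.

End OtimesUpperGamma.

(** * Growth of La *)

Section Growth.
Variables (dP dQ : Order.disp_t) (P : finPOrderType dP) (Q : finPOrderType dQ).
Variable a : nat.

(** The members of [F] that do not separate [x] from [lift x y]; indexing by [lift] makes the two
    points different. *)
Definition same_type (F : {set {set 'I_a.+1}}) (x : 'I_a.+1) (y : 'I_a) :=
  [set A in F | (x \in A) == (lift x y \in A)].

Lemma copies_same_type (F : {set {set 'I_a.+1}}) x y :
  poset_free P F -> copies Q (same_type F x y) <= La a P Q.
Proof.
(* The map [c] merges [x] with [lift x y], and the sets not separating the two are preimages under
   [c]. *)
move=> F_free; pose c t := odflt y (unlift x t).
have cK z : c (lift x z) = z by rewrite /c liftK.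
apply: (@leq_La_embedding _ _ _ _ _ _ (fun B : {set 'I_a} => c @^-1: B)).
- move=> A B; apply/idP/idP => [/subsetP sAB|]; last exact: preimsetS.
  by apply/subsetP => z zA; have := sAB (lift x z); rewrite !inE cK; apply.
- move=> A; rewrite inE => /andP[_ /eqP eA]; exists (lift x @^-1: A).
  apply/setP => t; rewrite !inE /c; case: unliftP => [z -> //|->] /=.
  by rewrite -eA.
- by apply: poset_free_subset F_free; apply/subsetP => A; rewrite inE => /andP[].
Qed.

(* By Cauchy-Schwarz at least about [1 / 2 ^ #|Q|] of all pairs of points are not
   separated by a given copy, and merging such a pair maps the copy to ['I_a]. *)
Lemma La_growth : 2 * 2 ^ #|Q| <= a.+1 ->
  La a.+1 P Q <= 2 * 2 ^ #|Q| * La a P Q.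
Proof.
move=> le_a; apply/bigmax_leqP => F F_free.
pose C := [set G : {set {set 'I_a.+1}} | (G \subset F) && is_copy Q G].
have count (G : {set {set 'I_a.+1}}) : G \in C ->
    a.+1 ^ 2 <= 2 * 2 ^ #|Q| * \sum_x \sum_y (G \subset same_type F x y : nat).
  rewrite inE => /andP[sGF cG].
  (* The trace of [x] on the copy: points with equal traces are not separated by it. *)
  pose f (x : 'I_a.+1) := [set i : 'I_#|G| | x \in enum_val i].
  have := card_collisions setT f.
  rewrite cardsT card_ord -[#|{: {set 'I_#|G|}}|]cardsT -powersetT card_powerset cardsT card_ord.
  have -> : #|[set p : 'I_a.+1 * 'I_a.+1 | [&& p.1 \in setT, p.2 \in setT & f p.1 == f p.2]]| =
      \sum_x \sum_y (f x == f y : nat).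
    rewrite pair_big /= -sum1dep_card big_mkcond /=; apply: eq_bigr => p _.
    by rewrite !inE /=; case: (_ == _).
  (* The diagonal gives [a.+1] pairs; by the hypothesis on [a], times [2 ^ #|Q|] they make at most
     half of [a.+1 ^ 2]. *)
  have -> : \sum_x \sum_y (f x == f y : nat) =
      a.+1 + \sum_x \sum_y (f x == f (lift x y) : nat).
    transitivity (\sum_(x < a.+1) (1 + \sum_y (f x == f (lift x y) : nat))).
      by apply: eq_bigr => x _; rewrite (bigD1_ord x) //= eqxx.
    by rewrite big_split /= sum1_card card_ord.
  have -> : \sum_x \sum_y (f x == f (lift x y) : nat) =
      \sum_x \sum_y (G \subset same_type F x y : nat).
    apply: eq_bigr => x _; apply: eq_bigr => y _; congr (nat_of_bool _).
    apply/eqP/subsetP => [eq_f A AG|sG].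
      rewrite inE (subsetP sGF) //=; apply/eqP.
      by have /setP/(_ (enum_rank_in AG A)) := eq_f; rewrite !inE enum_rankK_in.
    apply/setP => i; rewrite !inE.
    by have := sG _ (enum_valP i); rewrite inE => /andP[_ /eqP].
  rewrite (card_copy cG).
  move: (2 ^ #|Q|) le_a (\sum_x _) => T le_a s; nia.
have le_sum : #|C| * a.+1 ^ 2 <= 2 * 2 ^ #|Q| * (a.+1 * (a * La a P Q)).
  rewrite -sum_nat_const; apply: (@leq_trans (\sum_(G in C) (2 * 2 ^ #|Q| *
      \sum_x \sum_y (G \subset same_type F x y : nat)))); first exact: leq_sum.
  rewrite -big_distrr leq_mul2l; apply/orP; right.
  rewrite exchange_big /= -[X in X * _]card_ord -sum_nat_const; apply: leq_sum => x _.
  rewrite exchange_big /= -[X in X * _]card_ord -sum_nat_const; apply: leq_sum => y _.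
  apply: leq_trans (copies_same_type x y F_free).
  rewrite /copies -sum1dep_card [X in _ <= X]big_mkcond [X in X <= _]big_mkcond.
  apply: leq_sum => G _; rewrite inE; case: (boolP (G \subset same_type F x y)); last by case: ifP.
  by move=> _ /=; case: (G \subset F); case: is_copy.
rewrite -(leq_pmul2r (isT : 0 < a.+1 ^ 2)); apply: leq_trans le_sum _.
by rewrite -[X in _ <= X]mulnA leq_mul2l; apply/orP; right; nia.
Qed.

End Growth.

(** * Families of full levels *)

Section Levels.

Definition levels n (s : seq nat) : {set {set 'I_n}} := [set A : {set 'I_n} | #|A| \in s].

Lemma card_set_ord_le n (A : {set 'I_n}) : #|A| <= n.
Proof. by rewrite -[leqRHS]card_ord max_card. Qed.

Lemma levels_free n l s : size s <= l -> poset_free (chain_poset (l + 1)) (levels n s).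
Proof.
move=> le_s; apply/chain_freeP => c srt_c sub_c sz_c.
have : uniq [seq #|A : {set 'I_n}| | A <- c].
  have: sorted ltn [seq #|A : {set 'I_n}| | A <- c].
    by rewrite sorted_map; apply: sub_sorted srt_c => A B; apply: proper_card.
  by apply: sorted_uniq ltn_trans ltnn _.
move/uniq_leq_size => /(_ s) le_c.
have /le_c : {subset [seq #|A : {set 'I_n}| | A <- c] <= s}.
  by move=> _ /mapP[A /sub_c + ->]; rewrite inE.
by rewrite size_map sz_c addn1 ltnNge le_s.
Qed.

Lemma levels_union n s : union_of_full_levels (levels n s).
Proof.
exists [set k : 'I_n.+1 | val k \in s]; apply/setP => A; rewrite inE.
apply/idP/bigcupP => [As|[k]]; last by rewrite !inE => ks /eqP->.
have lt_A : #|A| < n.+1 by rewrite ltnS card_set_ord_le.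
by exists (Ordinal lt_A); rewrite !inE /=.
Qed.

Lemma union_levels n (F : {set {set 'I_n}}) : union_of_full_levels F ->
  exists s, [/\ uniq s, {in s, forall k, k <= n} & F = levels n s].
Proof.
case=> S ->; exists [seq val k | k <- enum S]; split.
- by rewrite map_inj_uniq ?enum_uniq //; apply: val_inj.
- by move=> _ /mapP[k _ ->]; rewrite -ltnS ltn_ord.
- apply/setP => A; rewrite inE; apply/bigcupP/mapP => [[k kS]|[k]].
    by rewrite inE => /eqP->; exists k; rewrite ?mem_enum.
  by rewrite mem_enum => kS cA; exists k; rewrite ?inE ?cA.
Qed.

Lemma levels_free_size n l s : uniq s -> {in s, forall k, k <= n} ->
  poset_free (chain_poset (l + 1)) (levels n s) -> size s <= l.
Proof.
move=> us le_s /chain_freeP F_free; rewrite leqNgt; apply/negP => lt_ls.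
pose t := take (l + 1) (sort leq s).
have sub_t k : k \in t -> k \in s by move/mem_take; rewrite mem_sort.
(* Initial segments form a chain through all levels. *)
pose pre k := [set i : 'I_n | i < k].
have card_pre k : k <= n -> #|pre k| = k.
  move=> le_k; have inj_w : injective (widen_ord le_k).
    by move=> i j /(congr1 val) /= /val_inj.
  rewrite -[RHS]card_ord -(card_imset _ inj_w).
  apply: eq_card => i; rewrite inE; apply/idP/imsetP => [lt_i|[j _ ->]].
    by exists (Ordinal lt_i) => //; apply: val_inj.
  by rewrite /= ltn_ord.
apply: (F_free [seq pre k | k <- t]).
- have : sorted ltn t.
    apply: take_sorted; rewrite ltn_sorted_uniq_leq sort_uniq us /=.
    exact/sort_sorted/leq_total.
  rewrite sorted_map; apply: (sub_in_sorted (P := [in t])); last exact/allP.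
  move=> i j it jt lt_ij; have le_t k : k \in t -> k <= n by move/sub_t/le_s.
  rewrite /relpre /sproper /= properEcard !card_pre ?le_t // [X in _ && X]lt_ij andbT.
  by apply/subsetP => k; rewrite !inE => /ltn_trans->.
- by move=> _ /mapP[k kt ->]; rewrite inE card_pre; [apply: sub_t|apply/le_s/sub_t].
- by rewrite size_map size_takel // size_sort addn1.
Qed.

End Levels.

(** * Optimal unions of full levels *)

Section BestLevels.
Variables (d : Order.disp_t) (Q : finPOrderType d).

Definition max_levels n l := \max_(S : {set 'I_n.+1} | #|S| <= l)
  copies Q (levels n [seq val k | k <- enum S]).

Lemma max_levels_ge n l s : size s <= l -> copies Q (levels n s) <= max_levels n l.
Proof.
move=> le_s; pose S := [set k : 'I_n.+1 | val k \in s].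
have le_S : #|S| <= l.
  apply: leq_trans le_s; rewrite cardE -(size_map val); apply: uniq_leq_size.
    by rewrite map_inj_uniq ?enum_uniq //; apply: val_inj.
  by move=> _ /mapP[k + ->]; rewrite mem_enum inE.
apply: leq_trans (leq_bigmax_cond _ le_S); apply: copies_subset.
apply/subsetP => A; rewrite !inE => As.
have lt_A : #|A| < n.+1 by rewrite ltnS card_set_ord_le.
by apply/mapP; exists (Ordinal lt_A); rewrite // mem_enum inE.
Qed.

Lemma max_levels_attained n l :
  { s | size s <= l & max_levels n l = copies Q (levels n s) }.
Proof.
have ne : 0 < #|[pred S : {set 'I_n.+1} | #|S| <= l]|.
  by apply/card_gt0P; exists set0; rewrite inE cards0.
have [S le_S eS] := eq_bigmax_cond (fun S : {set 'I_n.+1} =>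
  copies Q (levels n [seq val k | k <- enum S])) ne.
by exists [seq val k | k <- enum S]; rewrite // size_map -cardE.
Qed.

Lemma max_levels_le_La n l : max_levels n l <= La n (chain_poset (l + 1)) Q.
Proof. by have [s le_s ->] := max_levels_attained n l; apply/leq_La/levels_free. Qed.

Lemma copies_union_levels n l (F : {set {set 'I_n}}) :
    poset_free (chain_poset (l + 1)) F -> union_of_full_levels F ->
  copies Q F <= max_levels n l.
Proof.
move=> F_free /union_levels[s [us le_s eF]]; rewrite eF in F_free *.
by apply: max_levels_ge; apply: levels_free_size F_free.
Qed.

(** Unions of full levels without a chain of [l + 1] sets are those of at most [l] levels, so
    [max_levels] is the best value such a family can reach. *)
Lemma level_conj_stronglyP l : level_conj_strongly (chain_poset (l + 1)) Q <->
  exists N, forall n, N <= n -> La n (chain_poset (l + 1)) Q <= max_levels n l.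
Proof.
split=> -[N conj]; exists N => n /conj; first by case=> F [F_free uF ->]; apply: copies_union_levels.
move=> le_La; have [s le_s es] := max_levels_attained n l.
exists (levels n s); split; [exact: levels_free|exact: levels_union|].
by apply/eqP; rewrite -es eqn_leq le_La max_levels_le_La.
Qed.

Lemma level_conj_almostP l : level_conj_almost (chain_poset (l + 1)) Q <->
  exists k C N, forall n, N <= n ->
    La n (chain_poset (l + 1)) Q <= C * (n ^ k * max_levels n l).
Proof.
split=> [[F [FP [k [C [N le_La]]]]]|[k [C [N le_La]]]].
  exists k, C, N => n /le_La/leq_trans; apply; rewrite !leq_mul2l.
  by have [F_free uF] := FP n; rewrite copies_union_levels ?orbT.
exists (fun n => levels n (s2val (max_levels_attained n l))); split.
  by move=> n; case: max_levels_attained => s le_s _ /=; split; [exact: levels_free|exact: levels_union].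
by exists k, C, N => n; rewrite -(s2valP' (max_levels_attained n l)); apply: le_La.
Qed.

End BestLevels.

Section OtimesLevels.
Variables (d1 d2 : Order.disp_t).
Variables (Q1 : finPOrderType d1) (Q2 : finPOrderType d2).

Lemma copies_levels_interval (d : Order.disp_t) (Q : finPOrderType d) n a s
    (I D : {set 'I_n}) (F : {set {set 'I_n}}) : [disjoint I & D] -> #|D| = a ->
    (forall A : {set 'I_n}, I \subset A -> A \subset I :|: D -> #|A| - #|I| \in s -> A \in F) ->
  copies Q (levels a s) <= copies Q F.
Proof.
move=> disjID <- FID; rewrite -(copies_embedding Q (interval_embeddingS disjID)).
apply: copies_subset; apply/subsetP => _ /imsetP[A + ->]; rewrite inE => As.
apply: FID; first exact: subsetUl.
  by apply: setUS; apply/subsetP => _ /imsetP[x _ ->]; apply: enum_valP.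
by rewrite card_interval_embedding // addKn.
Qed.

(** The family consists of the levels [s1], level [h] for the middle sets, and the levels [s2]
    shifted by [n - c]. Each [R] is extended by copies below [I R] and above [J R], which may leave
    a gap to [R]; the size conditions give proper inclusions. *)
Lemma max_levels_otimes_ge r n h a c l1 l2 s1 s2
    (RR : {set {set {set 'I_n}}}) (I J : {set {set 'I_n}} -> {set 'I_n}) :
    0 < r -> c <= n -> size s1 <= l1 -> size s2 <= l2 ->
    (forall R, R \in RR -> [/\ R \subset full_level n h, #|R| = r,
       #|I R| = a, #|~: J R| = c & forall M, M \in R -> I R \subset M /\ M \subset J R]) ->
    (forall k, k \in s1 -> k <= a -> k < h) -> (forall k, k \in s2 -> h < n - c + k) ->
  #|RR| * (copies Q1 (levels a s1) * copies Q2 (levels c s2)) <=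
  max_levels (otimes r Q1 Q2) n (l1 + l2 + 1).
Proof.
move=> r_gt0 le_cn le_s1 le_s2 RRP lt_s1 lt_s2.
pose s := s1 ++ h :: map (addn (n - c)) s2.
apply: leq_trans (@max_levels_ge _ _ n _ s _); last first.
  by rewrite size_cat /= size_map -addnA addn1 leq_add.
apply: leq_trans (copies_otimes_ge Q1 Q2 r_gt0 _ (@antichain_full_level n h)); last first.
  by apply/subsetP => A; rewrite !inE => /eqP->; rewrite mem_cat inE eqxx orbT.
rewrite -sum_nat_const [X in _ <= X](bigID (mem RR)) /=; apply: leq_trans (leq_addr _ _).
rewrite [X in _ <= X](eq_bigl (mem RR)); last first.
  move=> R /=; case: (boolP (R \in RR)) => [RRR|]; last by rewrite andbF.
  by have [-> -> _ _ _] := RRP R RRR; rewrite eqxx.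
apply: leq_sum => R RRR; have [/subsetP sRh cR cI cJ IRJ] := RRP R RRR.
apply: leq_mul.
  apply: (@copies_levels_interval _ _ _ _ _ set0 (I R)) => //.
    by rewrite disjoints_subset sub0set.
  move=> A _; rewrite set0U cards0 subn0 => sAI As1; apply/strictly_belowP; split.
    by rewrite inE mem_cat As1.
  move=> M MR; rewrite properEcard (subset_trans sAI) /=; last by case: (IRJ M MR).
  have := sRh M MR; rewrite inE => /eqP->; apply: lt_s1 => //.
  by rewrite -cI subset_leq_card.
have cJ' : #|J R| = n - c.
  by have := card_setC_ord (J R); rewrite cJ; have := card_set_ord_le (J R); lia.
apply: (@copies_levels_interval _ _ _ _ _ (J R) (~: J R)) => //.
  by rewrite disjoints_subset setCK.
move=> A sJA _ As2; apply/strictly_aboveP.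
have le_A := subset_leq_card sJA; split.
  rewrite inE mem_cat inE; apply/orP; right; apply/orP; right; apply/mapP.
  by exists (#|A| - #|J R|); rewrite // -cJ' subnKC.
move=> M MR; rewrite properEcard (subset_trans _ sJA) /=; last by case: (IRJ M MR).
have := sRh M MR; rewrite inE => /eqP->.
by have := lt_s2 _ As2; rewrite -cJ' subnKC.
Qed.

End OtimesLevels.

(** * Moving units between the parts of a multinomial coefficient *)

Section Moves.

(** The regularity shared by [La] and the powers of a constant, sufficient for moving units between
    parts. *)
Definition tame K (f : nat -> nat) :=
  forall n, f n <= f n.+1 /\ (K <= n.+1 -> f n.+1 <= K * f n).

Lemma tame_mono K f : tame K f -> {homo f : m n / m <= n}.
Proof. by move=> tf; apply: homo_leq => [//|??? |n]; [exact: leq_trans|case: (tf n)]. Qed.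

Lemma tame_leq K K' f : K <= K' -> tame K f -> tame K' f.
Proof.
move=> le_K tf n; have [le_f gr_f] := tf n; split=> // le_n.
by apply: leq_trans (gr_f (leq_trans le_K le_n)) _; rewrite leq_mul2r le_K orbT.
Qed.

Lemma tame_expn K b : 0 < b <= K -> tame K (expn b).
Proof.
case/andP=> b_gt0 le_bK n; rewrite expnS leq_pmull //; split=> // _.
by rewrite leq_mul2r le_bK orbT.
Qed.

Lemma tame_La (dP dQ : Order.disp_t) (P : finPOrderType dP) (Q : finPOrderType dQ) :
  tame (2 * 2 ^ #|Q|) (fun n => La n P Q).
Proof. by move=> n; split; [apply: La_leS|apply: La_growth]. Qed.

(* Fractions [p / q] are compared by cross multiplication. *)
Lemma frac_trans p1 q1 p2 q2 p3 q3 : 0 < q2 ->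
  p1 * q2 <= p2 * q1 -> p2 * q3 <= p3 * q2 -> p1 * q3 <= p3 * q1.
Proof.
move=> q2_gt0 le12 le23; rewrite -(leq_pmul2r q2_gt0).
rewrite mulnAC; apply: (@leq_trans (p2 * q1 * q3)); first by rewrite leq_mul2r le12 orbT.
by rewrite mulnAC [X in _ <= X]mulnAC leq_mul2r le23 orbT.
Qed.

(* [f a * h c / (a! c!)] does not decrease when units are moved from a large [c]
   to a small [a]. *)
Lemma move_units K A f h a c t : 0 < K -> {homo f : m n / m <= n} -> tame K h ->
    a + t <= A -> K * A + K + t <= c ->
  f a * h c * ((a + t)`! * (c - t)`!) <= f (a + t) * h (c - t) * (a`! * c`!).
Proof.
move=> K_gt0 f_mono th; elim: t => [|t IHt] le_a le_c; first by rewrite addn0 subn0.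
apply: (frac_trans (p2 := f (a + t) * h (c - t)) (q2 := (a + t)`! * (c - t)`!)).
- by rewrite muln_gt0 !fact_gt0.
- by apply: IHt; lia.
have -> : c - t = (c - t.+1).+1 by lia.
have : K * (a + t).+1 <= (c - t.+1).+1 by nia.
rewrite addnS; move: (a + t) (c - t.+1) => b c' le_c'.
have h_step : h c'.+1 * b.+1 <= h c' * c'.+1.
  have [_ gr_h] := th c'; apply: (@leq_trans (K * h c' * b.+1)).
    by rewrite leq_mul2r gr_h ?orbT //; nia.
  by rewrite [K * _]mulnC -mulnA leq_mul2l le_c' orbT.
rewrite !factS; apply: (@leq_trans (f b * (h c'.+1 * b.+1) * (b`! * c'`!))); first by apply: eq_leq; lia.
apply: (@leq_trans (f b.+1 * (h c' * c'.+1) * (b`! * c'`!))); last by apply: eq_leq; lia.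
by rewrite leq_mul2r; apply/orP; right; apply: leq_mul => //; apply: f_mono.
Qed.

(** The transfer of [A - a] units is empty, by truncated subtraction, when [a] is already at least
    [A]. *)
Lemma raise2 K A f h a c : 0 < K -> {homo f : m n / m <= n} -> tame K h ->
    K * A + K + A + A <= c -> exists a' c', [/\ A <= a', c - A <= c', a' + c' = a + c &
  f a * h c * (a'`! * c'`!) <= f a' * h c' * (a`! * c`!)].
Proof.
move=> K_gt0 f_mono th le_c; exists (a + (A - a)), (c - (A - a)).
split; try lia; have [le_aA|lt_Aa] := leqP a A.
  by apply: (@move_units K A) => //; lia.
by rewrite (_ : A - a = 0) ?addn0 ?subn0 //; lia.
Qed.

Lemma raise3 K A f g h a b c : 0 < K ->
    {homo f : m n / m <= n} -> {homo g : m n / m <= n} -> tame K h ->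
    K * A + K + A + A + A <= c -> exists a' b' c',
    [/\ A <= a', A <= b', A <= c', a' + b' + c' = a + b + c &
  f a * g b * h c * (a'`! * b'`! * c'`!) <= f a' * g b' * h c' * (a`! * b`! * c`!)].
Proof.
move=> K_gt0 f_mono g_mono th le_c.
have [a' [c1 [le_a' le_c1 eac le1]]] := @raise2 K A f h a c K_gt0 f_mono th ltac:(lia).
have [b' [c' [le_b' le_c' ebc le2]]] := @raise2 K A g h b c1 K_gt0 g_mono th ltac:(lia).
exists a', b', c'; split; try lia.
apply: (frac_trans (p2 := f a' * g b * h c1) (q2 := a'`! * b`! * c1`!)).
- by rewrite !muln_gt0 !fact_gt0.
- rewrite (_ : _ * _ = f a * h c * (a'`! * c1`!) * (g b * b`!)); last by lia.
  rewrite (_ : f a' * g b * h c1 * _ = f a' * h c1 * (a`! * c`!) * (g b * b`!)); last by lia.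
  by rewrite leq_mul2r le1 orbT.
- rewrite (_ : _ * _ = g b * h c1 * (b'`! * c'`!) * (f a' * a'`!)); last by lia.
  rewrite (_ : f a' * g b' * h c' * _ = g b' * h c' * (b`! * c1`!) * (f a' * a'`!)); last by lia.
  by rewrite leq_mul2r le2 orbT.
Qed.

(** Since [n] is at least twice the size required of a donor, one of the two parts can raise the
    other. *)
Lemma raise_binomial K A f h : 0 < K -> tame K f -> tame K h -> exists N, forall n a c,
    N <= n -> a + c = n -> exists a' c', [/\ A <= a', A <= c', a' + c' = n &
  'C(n, a) * f a * h c <= 'C(n, a') * f a' * h c'].
Proof.
move=> K_gt0 tf th; exists (2 * (K * A + K + A + A + A)) => n a c le_n en.
have [a' [c' [le_a' le_c' en' le_frac]]] : exists a' c', [/\ A <= a', A <= c', a' + c' = a + c &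
    f a * h c * (a'`! * c'`!) <= f a' * h c' * (a`! * c`!)].
  have [le_c|lt_c] := leqP (K * A + K + A + A) c.
    have [a' [c' [? ? ? le_frac]]] := raise2 a K_gt0 (tame_mono tf) th le_c.
    by exists a', c'; split=> //; lia.
  have [c' [a' [? ? ? le_frac]]] := @raise2 K A h f c a K_gt0 (tame_mono th) tf ltac:(lia).
  by exists a', c'; split=> //; [lia|lia|move: le_frac; clear; lia].
exists a', c'; split=> //; first by rewrite en'.
have bin_fact2 x y : x + y = n -> 'C(n, x) * (x`! * y`!) = n`!.
  by move=> <-; rewrite -{2}(addKn x y) bin_fact // leq_addr.
have pos : 0 < a`! * c`! * (a'`! * c'`!) by rewrite !muln_gt0 !fact_gt0.
rewrite -(leq_pmul2r pos).
rewrite (_ : _ * _ = 'C(n, a) * (a`! * c`!) * (f a * h c * (a'`! * c'`!))); last by lia.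
rewrite (_ : 'C(n, a') * _ * _ * _ = 'C(n, a') * (a'`! * c'`!) * (f a' * h c' * (a`! * c`!))); last by lia.
by rewrite !bin_fact2 ?en' // leq_mul2l le_frac orbT.
Qed.

Lemma raise_trinomial K A f g h : 0 < K -> tame K f -> tame K g -> tame K h ->
  exists N, forall n a b c, N <= n -> a + b + c = n ->
    exists a' b' c', [/\ A <= a', A <= b', A <= c', a' + b' + c' = n &
  'C(n, a + b) * 'C(a + b, a) * (f a * g b * h c) <=
  'C(n, a' + b') * 'C(a' + b', a') * (f a' * g b' * h c')].
Proof.
move=> K_gt0 tf tg th; pose D := K * A + K + A + A + A; exists (3 * D) => n a b c le_n en.
have [a' [b' [c' [le_a' le_b' le_c' en' le_frac]]]] : exists a' b' c',
    [/\ A <= a', A <= b', A <= c', a' + b' + c' = a + b + c &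
    f a * g b * h c * (a'`! * b'`! * c'`!) <= f a' * g b' * h c' * (a`! * b`! * c`!)].
  have [mf mg mh] := And3 (tame_mono tf) (tame_mono tg) (tame_mono th).
  have [le_c|lt_c] := leqP D c; first exact: raise3 le_c.
  have [le_b|lt_b] := leqP D b.
    have [a' [c' [b' [? ? ? ? le_frac]]]] := raise3 a c K_gt0 mf mh tg le_b.
    by exists a', b', c'; split=> //; [lia|move: le_frac; clear; lia].
  have [b' [c' [a' [? ? ? ? le_frac]]]] := @raise3 K A g h f b c a K_gt0 mg mh tf ltac:(lia).
  by exists a', b', c'; split=> //; [lia|move: le_frac; clear; lia].
exists a', b', c'; split=> //; first by rewrite en'.
have bin_fact3 x y z : x + y + z = n ->
    'C(n, x + y) * 'C(x + y, x) * (x`! * y`! * z`!) = n`!.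
  move=> <-; have := bin_fact (leq_addr y x); rewrite addKn => e1.
  have := bin_fact (leq_addr z (x + y)); rewrite addKn => <-.
  by rewrite -e1; lia.
have pos : 0 < a`! * b`! * c`! * (a'`! * b'`! * c'`!) by rewrite !muln_gt0 !fact_gt0.
rewrite -(leq_pmul2r pos).
rewrite (_ : _ * _ = 'C(n, a + b) * 'C(a + b, a) * (a`! * b`! * c`!) *
  (f a * g b * h c * (a'`! * b'`! * c'`!))); last by move: 'C(_, _) 'C(_, _) => *; lia.
rewrite (_ : 'C(n, a' + b') * _ * _ * _ = 'C(n, a' + b') * 'C(a' + b', a') * (a'`! * b'`! * c'`!) *
  (f a' * g b' * h c' * (a`! * b`! * c`!))); last by move: 'C(_, _) 'C(_, _) => *; lia.
by rewrite !bin_fact3 ?en' // leq_mul2l le_frac orbT.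
Qed.

End Moves.

(** * Lower bounds from full levels *)

Section LevelFamilies.
Variables (d1 d2 : Order.disp_t).
Variables (Q1 : finPOrderType d1) (Q2 : finPOrderType d2).
Local Notation l1 := (height Q1).
Local Notation l2 := (height Q2).
Local Notation La1 n := (La n (chain_poset (height Q1 + 1)) Q1).
Local Notation La2 n := (La n (chain_poset (height Q2 + 1)) Q2).

Lemma max_levels_otimes1_ge n h a c s1 s2 (I J : {set 'I_n} -> {set 'I_n}) :
    c <= n -> size s1 <= l1 -> size s2 <= l2 ->
    (forall M : {set 'I_n}, #|M| = h ->
       [/\ #|I M| = a, #|~: J M| = c, I M \subset M & M \subset J M]) ->
    (forall k, k \in s1 -> k <= a -> k < h) -> (forall k, k \in s2 -> h < n - c + k) ->
  'C(n, h) * (copies Q1 (levels a s1) * copies Q2 (levels c s2)) <=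
  max_levels (otimes 1 Q1 Q2) n (l1 + l2 + 1).
Proof.
move=> le_cn le_s1 le_s2 IJ lt_s1 lt_s2.
rewrite -card_full_level -(card_imset _ (@set1_inj _)).
apply: (@max_levels_otimes_ge _ _ _ _ 1 n h a c _ _ s1 s2 _
  (fun R => I (\bigcap_(M in R) M)) (fun R => J (\bigcap_(M in R) M))) => //.
move=> _ /imsetP[M + ->]; rewrite inE => /eqP cM; rewrite !big_set1.
have [cI cJ sI sJ] := IJ M cM; split; rewrite ?cards1 //.
  by rewrite sub1set inE cM.
by move=> N; rewrite inE => /eqP->.
Qed.

(** Copies of [Q1] lie under [M] minus a point and copies of [Q2] over [M] plus a point, so
    inclusions are proper whatever levels are used. *)
Lemma max_levels_otimes1_gap n a c : a.+1 + c.+1 = n ->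
  'C(n, a.+1) * (max_levels Q1 a l1 * max_levels Q2 c l2) <=
  max_levels (otimes 1 Q1 Q2) n (l1 + l2 + 1).
Proof.
move=> en; have [s1 le_s1 ->] := max_levels_attained Q1 a l1.
have [s2 le_s2 ->] := max_levels_attained Q2 c l2.
pose del (M : {set 'I_n}) := if [pick x in M] is Some x then M :\ x else M.
apply: (@max_levels_otimes1_ge _ _ _ _ _ _ del (fun M => ~: del (~: M))) => //.
- by lia.
- have delP (M : {set 'I_n}) k : #|M| = k.+1 -> #|del M| = k /\ del M \subset M.
    rewrite /del; case: pickP => [x xM|M0] cM; last by rewrite eq_card0 in cM.
    by split; [have := cardsD1 x M; rewrite xM cM => -[]|apply: subsetDl].
  move=> M cM; have [-> ->] := delP _ _ cM.
  have cCM : #|~: M| = c.+1 by rewrite card_setC_ord; lia.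
  by have [cdel sdel] := delP _ _ cCM; rewrite setCK cdel -setCS setCK sdel.
- by move=> k _; lia.
Qed.

Lemma almost_otimes1 :
  level_conj_almost (chain_poset (l1 + 1)) Q1 ->
  level_conj_almost (chain_poset (l2 + 1)) Q2 ->
  level_conj_almost (chain_poset (l1 + l2 + 1 + 1)) (otimes 1 Q1 Q2).
Proof.
case/level_conj_almostP => k1 [C1 [N1 le1]] /level_conj_almostP[k2 [C2 [N2 le2]]].
apply/level_conj_almostP; pose K := 2 * 2 ^ #|Q1| + 2 * 2 ^ #|Q2|.
have K_gt0 : 0 < K by rewrite addn_gt0 muln_gt0 expn_gt0.
have t1 := tame_leq (leq_addr _ _ : 2 * 2 ^ #|Q1| <= K) (tame_La (chain_poset (l1 + 1)) Q1).
have t2 := tame_leq (leq_addl _ _ : 2 * 2 ^ #|Q2| <= K) (tame_La (chain_poset (l2 + 1)) Q2).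
have [N raise] := raise_binomial (N1 + N2 + K + 1) K_gt0 t1 t2.
exists (k1 + k2), (K * C1 * (K * C2)), N => n le_n.
rewrite -addnA; apply: leq_trans (La_otimes1_le _ _ _) _; apply/bigmax_leqP => j _.
have [a [c [le_a le_c en /leq_trans]]] := raise n j (n - j) le_n (subnKC (ltnSE (ltn_ord j))).
(* The raised parts are positive, so one point on each side of the middle set can be given up, at
   the cost of a factor [K] each by tameness. *)
apply; move: a c le_a le_c en => [|a] [|c]; try lia; move=> le_a le_c en.
have bound (f : nat -> nat) (g : nat -> nat) k C M x : tame K f ->
    (forall m, M <= m -> f m <= C * (m ^ k * g m)) -> K + M <= x -> x <= n ->
    f x.+1 <= K * C * (n ^ k * g x).
  move=> tf le_f le_x le_xn; have [_ /(_ ltac:(lia)) le_S] := tf x.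
  apply: leq_trans le_S _; rewrite -mulnA leq_mul2l; apply/orP; right.
  apply: leq_trans (le_f x ltac:(lia)) _; rewrite leq_mul2l; apply/orP; right.
  rewrite leq_mul2r; apply/orP; right.
  by case: k {le_f} => // k; rewrite leq_exp2r.
have b1 := bound _ _ _ _ _ a t1 le1 ltac:(lia) ltac:(lia).
have b2 := bound _ _ _ _ _ c t2 le2 ltac:(lia) ltac:(lia).
rewrite -mulnA; apply: leq_trans (leq_mul (leqnn _) (leq_mul b1 b2)) _.
have := max_levels_otimes1_gap en; rewrite expnD.
move: (max_levels _ _ _) (max_levels Q1 _ _) (max_levels Q2 _ _) => m m1 m2 le_m.
rewrite (_ : _ * _ = K * C1 * (K * C2) * (n ^ k1 * n ^ k2) * ('C(n, a.+1) * (m1 * m2))).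
  by rewrite -[X in X <= _]mulnA !leq_mul2l le_m !orbT.
by move: 'C(n, _) (n ^ k1) (n ^ k2) => *; lia.
Qed.

Section Spanning.
Variables (r n a b c : nat).
Hypotheses (r_gt0 : 0 < r) (b_gt1 : 1 < b) (en : a + b + c = n).

(** The middle sets are the spanning [r]-sets of the middle levels of all intervals of dimension [b]
    with bottom of size [a]. As [b > 1], level [h] lies above [a] and below [a + b]. *)
Lemma max_levels_otimes_spanning :
  'C(n, a + b) * 'C(a + b, a) * gamma r (full_level b (b %/ 2)) *
    (max_levels Q1 a l1 * max_levels Q2 c l2) <=
  max_levels (otimes r Q1 Q2) n (l1 + l2 + 1).
Proof.
have [s1 le_s1 ->] := max_levels_attained Q1 a l1.
have [s2 le_s2 ->] := max_levels_attained Q2 c l2.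
pose h := a + b %/ 2.
pose RR := [set R : {set {set 'I_n}} | [&& R \subset full_level n h, #|R| == r,
  #|\bigcap_(M in R) M| == a & #|\bigcup_(M in R) M| == a + b]].
apply: (@leq_trans (#|RR| * (copies Q1 (levels a s1) * copies Q2 (levels c s2)))); last first.
  apply: (@max_levels_otimes_ge _ _ _ _ r n h a c _ _ s1 s2 _
    (fun R => \bigcap_(M in R) M) (fun R => \bigcup_(M in R) M)) => //; try by rewrite /h; lia.
  move=> R; rewrite [R \in RR]inE => /and4P[sR /eqP cR /eqP cap /eqP cup]; split=> //.
    by rewrite card_setC_ord cup; lia.
  by move=> M MR; split; [apply: bigcap_inf|apply: bigcup_sup].
rewrite leq_mul2r; apply/orP; right.
pose IJ := [set p : {set 'I_n} * {set 'I_n} | [&& #|p.2| == a + b, p.1 \subset p.2 & #|p.1| == a]].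
have cIJ : #|IJ| = 'C(n, a + b) * 'C(a + b, a).
  transitivity (\sum_(J in full_level n (a + b)) \sum_(I : {set 'I_n} | (I \subset J) && (#|I| == a)) 1).
    rewrite (exchange_big_dep predT) //= pair_big_dep /= sum1dep_card.
    by apply: eq_card => p; rewrite !inE.
  rewrite -card_full_level -sum_nat_const; apply: eq_bigr => J; rewrite inE => /eqP cJ.
  by rewrite sum1dep_card cards_draws cJ.
rewrite -cIJ -sum_nat_const -[X in _ <= X]sum1_card.
rewrite (partition_big (fun R : {set {set 'I_n}} => (\bigcap_(M in R) M, \bigcup_(M in R) M))
  (mem IJ)) /=; last first.
  move=> R; rewrite inE => /and4P[sR /eqP cR cap cup]; rewrite inE /= cap cup andbT /=.
  have /set0Pn[M MR] : R != set0 by rewrite -cards_eq0 cR -lt0n.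
  by apply: subset_trans (bigcup_sup M MR); apply: bigcap_inf.
apply: leq_sum => -[I J]; rewrite inE /= => /and3P[/eqP cJ sIJ /eqP cI].
have disjID : [disjoint I & J :\: I].
  by rewrite disjoint_sym disjoints_subset setDE subsetIr.
have eJ : I :|: (J :\: I) = J.
  apply/setP => x; rewrite !inE; case: (boolP (x \in I)) => //.
  by move/(subsetP sIJ) ->.
have := card_spanning_interval disjID (full_level n h) r_gt0; rewrite eJ.
have -> : interval_embedding I (D := J :\: I) @^-1: full_level n h = full_level #|J :\: I| (b %/ 2).
  by apply/setP => B; rewrite !inE card_interval_embedding // cI eqn_add2l.
rewrite (_ : #|J :\: I| = b) => [<-|]; last by rewrite cardsD (setIidPr sIJ) cJ cI addKn.
rewrite sum1dep_card; apply: subset_leq_card; apply/subsetP => R; rewrite !inE.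
case/and4P=> -> -> /eqP cap /eqP cup.
by rewrite cap cup cI cJ !eqxx.
Qed.

End Spanning.

Lemma almost_otimes r : 2 < r ->
  level_conj_almost (chain_poset (l1 + 1)) Q1 ->
  level_conj_almost (chain_poset (l2 + 1)) Q2 ->
  level_conj_almost (chain_poset (l1 + l2 + 1 + 1)) (otimes r Q1 Q2).
Proof.
move=> r_gt2 /level_conj_almostP[k1 [C1 [N1 le1]]] /level_conj_almostP[k2 [C2 [N2 le2]]].
have r_gt0 : 0 < r by apply: ltnW (ltnW _).
apply/level_conj_almostP; pose T := 2 ^ r - 2.
have T_gt0 : 0 < T.
  by have := leq_exp2l 2 r (isT : 1 < 2); rewrite /T (ltnW r_gt2) => ?; lia.
pose K := 2 * 2 ^ #|Q1| + 2 * 2 ^ #|Q2| + T.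
have K_gt0 : 0 < K by rewrite addn_gt0 T_gt0 orbT.
have le_K1 : 2 * 2 ^ #|Q1| <= K by rewrite /K; lia.
have le_K2 : 2 * 2 ^ #|Q2| <= K by rewrite /K; lia.
have t1 := tame_leq le_K1 (tame_La (chain_poset (l1 + 1)) Q1).
have t2 := tame_leq le_K2 (tame_La (chain_poset (l2 + 1)) Q2).
(* Tameness is available for the powers of [T] but not for [gamma], so parts are moved with [T ^ b]
   in place of [gamma]. *)
have tT : tame K (expn T) by apply: tame_expn; rewrite T_gt0 /K leq_addl.
have [N raise] := raise_trinomial (N1 + N2 + r) K_gt0 t1 tT t2.
(* The exponent [2 * r + 2] comes from the upper bound, [r.+1] from recovering [gamma] from [T ^ b],
   and [k1 + k2] from the two hypotheses. *)
exists (2 * r + 2 + (r.+1 + (k1 + k2))), (2 ^ r * r ^ r * (C1 * C2)), N.+1 => n le_n.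
rewrite -addnA; apply: leq_trans (La_otimes_le _ _ (ltnW r_gt2) _) _; first by lia.
rewrite [n ^ (_ + (_ + _))]expnD -[X in _ <= _ * X]mulnA [X in _ <= X]mulnCA leq_mul2l.
apply/orP; right; apply/bigmax_leqP => j _; apply/bigmax_leqP => i _.
have le_ij : i <= j by apply: ltnW.
have le_jn : j <= n by rewrite -ltnS.
have [a [b [c [le_a le_b le_c en le_raise]]]] :=
  raise n i (j - i) (n - j) (ltnW le_n) ltac:(lia).
rewrite (subnKC le_ij) in le_raise.
have le_gamma : gamma r (full_level (j - i) ((j - i) %/ 2)) <= T ^ (j - i).
  have := gamma_column_tuples r_gt0 (full_level (j - i) ((j - i) %/ 2)).
  by apply: leq_trans; rewrite leq_pmull // fact_gt0.
apply: (@leq_trans ('C(n, a + b) * 'C(a + b, a) * (La1 a * T ^ b * La2 c))).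
  apply: leq_trans le_raise; rewrite -!mulnA !leq_mul2l; do 2! (apply/orP; right).
  by rewrite mulnCA leq_mul2l leq_mul2r le_gamma !orbT.
have le_pow x k : x <= n -> x ^ k <= n ^ k by case: k => // k; rewrite leq_exp2r.
have b1 : La1 a <= C1 * (n ^ k1 * max_levels Q1 a l1).
  apply: leq_trans (le1 a ltac:(lia)) _.
  by rewrite leq_mul2l leq_mul2r le_pow ?orbT //; lia.
have b2 : La2 c <= C2 * (n ^ k2 * max_levels Q2 c l2).
  apply: leq_trans (le2 c ltac:(lia)) _.
  by rewrite leq_mul2l leq_mul2r le_pow ?orbT //; lia.
have bT : T ^ b <= 2 ^ r * r ^ r * (n ^ r.+1 * gamma r (full_level b (b %/ 2))).
  apply: leq_trans (column_tuples_le_gamma r_gt2 _) _; first by lia.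
  by rewrite leq_mul2l leq_mul2r le_pow ?orbT //; lia.
have le_m := @max_levels_otimes_spanning r n a b c r_gt0 ltac:(lia) en.
apply: (leq_trans (leq_mul (leqnn _) (leq_mul (leq_mul b1 bT) b2))).
rewrite !expnD; move: le_m; clear.
move: (gamma _ _) (max_levels (otimes _ _ _) _ _) (max_levels Q1 _ _) (max_levels Q2 _ _).
move=> g m m1 m2.
move: (_ * 'C(_, _)) (2 ^ r * r ^ r) (n ^ r.+1) (n ^ k1) (n ^ k2) => B R p q s le_m.
rewrite (_ : _ * _ = R * (C1 * C2) * (p * (q * s)) * (B * g * (m1 * m2))); last by lia.
by rewrite -[X in X <= _]mulnA !leq_mul2l le_m !orbT.
Qed.

End LevelFamilies.

(** * Optimal level families avoid the full set *)

Section Profiles.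
Variables (d : Order.disp_t) (Q : finPOrderType d).
Local Notation l := (height Q).
Implicit Types (sigma tau : Q -> nat).

(** Labelled copies of [Q] with prescribed set sizes. *)
Definition placements n sigma := [set phi : {ffun Q -> {set 'I_n}} |
  [&& injectiveb phi, [forall x, forall y, (x <= y)%O ==> (phi x \subset phi y)]
    & [forall x, #|phi x| == sigma x]]].

Lemma placementsP n sigma (phi : {ffun Q -> {set 'I_n}}) :
  reflect [/\ injective phi, forall x y, (x <= y)%O -> phi x \subset phi y
            & forall x, #|phi x| = sigma x] (phi \in placements n sigma).
Proof.
rewrite inE; apply: (iffP and3P) => [[/injectiveP inj /forallP mon /forallP sz]|[inj mon sz]].
  split=> // [x y le_xy|x]; last exact/eqP.
  by have /forallP/(_ y)/implyP := mon x; apply.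
split; first exact/injectiveP.
  by apply/forallP => x; apply/forallP => y; apply/implyP; apply: mon.
by apply/forallP => x; rewrite sz.
Qed.

Lemma card_placements_le n sigma : #|placements n sigma| <= (2 ^ #|Q|) ^ n.
Proof.
apply: leq_trans (max_card _) _.
by rewrite card_ffun -cardsT -powersetT card_powerset cardsT card_ord -!expnM mulnC.
Qed.

Lemma placements_copy n sigma phi : phi \in placements n sigma ->
  is_copy Q [set phi x | x : Q].
Proof. by case/placementsP=> inj mon _; apply/is_copyP; exists phi. Qed.

Lemma card_placements_copies n sigma s : (forall x, sigma x \in s) ->
  #|placements n sigma| <= #|Q| ^ #|Q| * copies Q (levels n s).
Proof.
move=> sig_s; pose C := [set G : {set {set 'I_n}} | (G \subset levels n s) && is_copy Q G].
pose B := [set p : {set {set 'I_n}} * {ffun Q -> {set 'I_n}} |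
  (p.1 \in C) && (p.2 \in ffun_on (mem p.1))].
have -> : #|Q| ^ #|Q| * copies Q (levels n s) = #|B|.
  rewrite -[RHS]sum1dep_card -(pair_big_dep (mem C)
    (fun G (t : {ffun Q -> {set 'I_n}}) => t \in ffun_on (mem G)) (fun _ _ => 1)) /=.
  rewrite mulnC -sum_nat_const; apply: eq_bigr => G.
  rewrite inE => /andP[_ /card_copy cG].
  by rewrite sum1_card card_ffun_on cG.
apply: (@card_le_surj _ _ _ _ snd) => phi phiP; exists ([set phi x | x : Q], phi) => //.
rewrite inE /=; apply/andP; split; last by apply/ffun_onP => x; apply: imset_f.
rewrite inE (placements_copy phiP) andbT; case/placementsP: phiP => _ _ sz.
by apply/subsetP => _ /imsetP[x _ ->]; rewrite inE sz.
Qed.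

(** Placements on disjoint ground sets are glued by unions; this supermultiplicativity underlies the
    exponential rate. *)
Lemma placements_add a b sigma tau :
  #|placements a sigma| * #|placements b tau| <=
  #|placements (a + b) (fun x => sigma x + tau x)|.
Proof.
pose join (p : {ffun Q -> {set 'I_a}} * {ffun Q -> {set 'I_b}}) : {ffun Q -> {set 'I_(a + b)}} :=
  [ffun x => [set i | match split i with inl y => y \in p.1 x | inr y => y \in p.2 x end]].
have joinl p x y : (lshift b y \in join p x) = (y \in p.1 x).
  by rewrite ffunE inE -[lshift b y]/(unsplit (inl y)) unsplitK.
have joinr p x y : (rshift a y \in join p x) = (y \in p.2 x).
  by rewrite ffunE inE -[rshift a y]/(unsplit (inr y)) unsplitK.
rewrite -cardsX -(card_imset _ (f := join)); last first.
  move=> [u v] [u' v'] /ffunP eq_join; congr (_, _); apply/ffunP => x; apply/setP => y.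
    by have := joinl (u, v) x y; rewrite eq_join joinl /= => ->.
  by have := joinr (u, v) x y; rewrite eq_join joinr /= => ->.
apply: subset_leq_card; apply/subsetP => _ /imsetP[p + ->].
case: p => u v; rewrite in_setX => /andP[/placementsP[inj1 mon1 sz1] /placementsP[inj2 mon2 sz2]].
apply/placementsP; split.
- move=> x x' eq_join; apply: inj1; apply/setP => y.
  by rewrite -(joinl (u, v)) eq_join joinl.
- move=> x x' le_x; apply/subsetP => i; rewrite -(splitK i).
  case: (split i) => y /=; first by rewrite !joinl; apply/subsetP/mon1.
  by rewrite !joinr; apply/subsetP/mon2.
- move=> x; rewrite -sum1_card big_mkcond big_split_ord /= -sz1 -sz2 -!sum1_card.
  rewrite [in RHS]big_mkcond [X in _ = _ + X]big_mkcond /=.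
  by congr (_ + _); apply: eq_bigr => y _; rewrite ?joinl ?joinr.
Qed.

Lemma placements_mul a sigma k :
  #|placements a sigma| ^ k.+1 <= #|placements (k.+1 * a) (fun x => k.+1 * sigma x)|.
Proof.
elim: k => [|k IHk].
  rewrite expn1 mul1n; apply/eq_leq/eq_card => phi.
  by apply/placementsP/placementsP => -[inj mon sz]; split=> // x; rewrite sz ?mul1n.
rewrite expnS; apply: leq_trans (leq_mul (leqnn _) IHk) _.
apply: leq_trans (placements_add _ _ _ _) _; rewrite -mulSn.
apply/eq_leq/eq_card => phi.
by apply/placementsP/placementsP => -[inj mon sz]; split=> // x; rewrite sz mulSn.
Qed.

Lemma placements_within n m sigma (D : {set 'I_n}) : #|D| = m ->
  #|placements m sigma| <=
  #|[set phi in placements n sigma | [forall x, phi x \subset D]]|.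
Proof.
move=> <-; have disjD : [disjoint set0 & D] by rewrite disjoints_subset sub0set.
have gS := interval_embeddingS disjD.
pose f (phi : {ffun Q -> {set 'I_#|D|}}) := [ffun x => interval_embedding set0 (D := D) (phi x)].
have f_inj : injective f.
  move=> phi psi /ffunP eqf; apply/ffunP => x.
  by have := eqf x; rewrite !ffunE => /(embedding_inj gS).
rewrite -(card_imset _ f_inj); apply: subset_leq_card; apply/subsetP => _ /imsetP[phi + ->].
case/placementsP=> inj mon sz; rewrite inE; apply/andP; split.
  apply/placementsP; split=> [x y|x y le_xy|x]; rewrite !ffunE.
  - by move/(embedding_inj gS)/inj.
  - by rewrite gS; apply: mon.
  - by rewrite card_interval_embedding // cards0 sz.
apply/forallP => x; rewrite ffunE /interval_embedding set0U.
by apply/subsetP => _ /imsetP[y _ ->]; apply: enum_valP.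
Qed.

(** Choose the image [D] of [x0] first: a placement inside the [m] points of [D] has [x0] sent to
    all of [D], so different [D] give different placements. *)
Lemma placements_pad m z sigma x0 : sigma x0 = m ->
  'C(m + z, m) * #|placements m sigma| <= #|placements (m + z) sigma|.
Proof.
move=> sig0; rewrite -card_full_level -sum_nat_const -[X in _ <= X]sum1_card.
rewrite (partition_big (fun phi : {ffun Q -> {set 'I_(m + z)}} => phi x0)
  (mem (full_level (m + z) m))) /=; last first.
  by move=> phi /placementsP[_ _ sz]; rewrite inE sz sig0.
apply: leq_sum => D; rewrite inE => /eqP cD; apply: leq_trans (placements_within _ cD) _.
rewrite sum1dep_card; apply: subset_leq_card; apply/subsetP => phi.
rewrite inE => /andP[phiP /forallP sD]; rewrite inE phiP /=.
by case/placementsP: phiP => _ _ sz; rewrite eqEcard sD sz sig0 cD /=.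
Qed.

Definition top_profile m sigma :=
  (exists x, sigma x = m) /\ size (undup [seq sigma x | x <- enum Q]) <= l.

(** Copies are split by their size functions, at most [l ^ #|Q|] in number, and the most frequent
    one is kept. *)
Lemma copies_top_profile n s : size s <= l -> n \in s -> 0 < copies Q (levels n s) ->
  exists2 sigma, top_profile n sigma &
    copies Q (levels n s) <= l ^ #|Q| * #|placements n sigma|.
Proof.
move=> le_s ns c_gt0.
pose S := [set k : 'I_n.+1 | val k \in s].
pose A := [set f : {ffun Q -> 'I_n.+1} in ffun_on (mem S)].
have cA : #|A| <= l ^ #|Q|.
  rewrite cardsE card_ffun_on; case: (posnP #|Q|) => [->|Q_gt0] //; rewrite leq_exp2r //.
  apply: leq_trans le_s; rewrite (cardE S) -(size_map val); apply: uniq_leq_size.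
    by rewrite map_inj_uniq ?enum_uniq //; apply: val_inj.
  by move=> _ /mapP[k + ->]; rewrite mem_enum inE.
have le_sum : copies Q (levels n s) <= \sum_(f in A) #|placements n (fun x => f x)|.
  pose B := [set p : {ffun Q -> 'I_n.+1} * {ffun Q -> {set 'I_n}} |
    (p.1 \in A) && (p.2 \in placements n (fun x => p.1 x))].
  have -> : \sum_(f in A) #|placements n (fun x => f x)| = #|B|.
    under eq_bigr => f _ do rewrite -sum1_card.
    by rewrite pair_big_dep /= sum1dep_card.
  apply: (@card_le_surj _ _ _ B (fun p => [set p.2 x | x : Q])) => G.
  rewrite inE => /andP[/subsetP sG /is_copyP[phi [inj mon eG]]].
  exists ([ffun x => inord #|phi x|], [ffun x => phi x]); last first.
    by rewrite eG; apply: eq_imset => x; rewrite /= ffunE.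
  have val_phi x : (inord #|phi x| : 'I_n.+1) = #|phi x| :> nat by rewrite inordK // ltnS card_set_ord_le.
  rewrite inE /=; apply/andP; split.
    rewrite inE; apply/ffun_onP => x; rewrite ffunE inE /= val_phi.
    by have : phi x \in G; [rewrite eG imset_f|move/sG; rewrite inE].
  apply/placementsP; split=> [x y|x y le_xy|x]; rewrite !ffunE ?val_phi //.
    exact: inj.
  exact: mon.
have A_neq0 : 0 < #|A|.
  by rewrite lt0n; apply: contraTneq c_gt0 => /eqP; rewrite cards_eq0 => /eqP A0;
    rewrite -leqNgt; apply: leq_trans le_sum _; rewrite A0 big_set0.
have [f fA ef] := eq_bigmax_cond (fun f : {ffun Q -> 'I_n.+1} => #|placements n (fun x => f x)|) A_neq0.
have le_f : copies Q (levels n s) <= l ^ #|Q| * #|placements n (fun x => f x)|.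
  apply: leq_trans le_sum _; apply: (@leq_trans (#|A| * #|placements n (fun x => f x)|)).
    by rewrite -ef -sum_nat_const; apply: leq_sum => g gA; apply: leq_bigmax_cond.
  by rewrite leq_mul2r cA orbT.
exists (fun x => nat_of_ord (f x)) => //.
have sfx x : val (f x) \in s by move: fA; rewrite inE => /ffun_onP/(_ x); rewrite inE.
split; last first.
  apply: leq_trans le_s; apply: uniq_leq_size; first exact: undup_uniq.
  by move=> k; rewrite mem_undup => /mapP[x _ ->]; apply: sfx.
apply: NNPP => no_top.
have /card_gt0P[phi phiP] : 0 < #|placements n (fun x => f x)|.
  rewrite lt0n; apply: contraTneq (leq_trans c_gt0 le_f) => ->.
  by rewrite muln0.
have [c [srt_c sub_c sz_c]] := copy_chain (placements_copy phiP).
have l_gt0 : 0 < l by apply: leq_trans le_s; case: (s) ns.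
(* Without level [n] at most [l - 1] levels remain, too few for the image of a longest chain of [Q];
   so some element is sent to the full set. *)
have sz_rem : size (filter (predC1 n) s) <= l.-1.
  rewrite -ltnS prednK //; apply: leq_trans le_s.
  rewrite size_filter -(count_predC (pred1 n) s) -[X in X < _]add0n ltn_add2r.
  by rewrite -has_count has_pred1.
have := levels_free n sz_rem; rewrite addn1 prednK // => /chain_freeP/(_ _ srt_c).
apply=> // B /sub_c /imsetP[x _ ->]; rewrite inE mem_filter /=.
case/placementsP: phiP => _ _ ->; rewrite sfx andbT.
by apply/eqP => fx; apply: no_top; exists x.
Qed.

End Profiles.

Lemma expn_le_bin u z : u ^ z <= 'C(u * z, z).
Proof.
have step m k : u * 'C(m, k) <= 'C(m + u, k.+1).
  elim: u => [|v IHv]; first by rewrite mul0n.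
  rewrite addnS binS mulSn addnC; apply: leq_add => //.
  by apply: leq_bin2l; apply: leq_addr.
elim: z => [|z IHz]; first by rewrite muln0.
rewrite expnS mulnS addnC; apply: leq_trans (step _ _).
by rewrite leq_mul2l IHz orbT.
Qed.

Lemma succ_expn_ge m i : (m + i) * m ^ i <= m * m.+1 ^ i.
Proof.
elim: i => [|i IHi]; first by rewrite addn0.
rewrite !expnS [m * (_ * _)]mulnCA; apply: leq_trans (leq_mul (leqnn m.+1) IHi).
rewrite !mulnA leq_mul2r; apply/orP; right; nia.
Qed.

(* Among the rates [h ^ (1 / j)] one is maximal up to the factor [(M + 1) / M]. *)
Lemma almost_maximal_rate (good : nat -> nat -> Prop) M T j1 h1 : 0 < M ->
    (forall j h, good j h -> h <= T ^ j) -> 0 < j1 -> good j1 h1 -> 0 < h1 ->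
  exists i j0 h0, [/\ 0 < j0, good j0 h0, M.+1 ^ (i * j0) <= h0 * M ^ (i * j0),
    M.+1 ^ i <= T * M ^ i &
    forall j h, 0 < j -> good j h -> h * M ^ (i.+1 * j) < M.+1 ^ (i.+1 * j)].
Proof.
move=> M_gt0 le_T j1_gt0 good1 h1_gt0.
pose P i := exists j h, [/\ 0 < j, good j h & M.+1 ^ (i * j) <= h * M ^ (i * j)].
have P_le i : P i -> M.+1 ^ i <= T * M ^ i.
  case=> j [h [j_gt0 /le_T le_h le_i]]; rewrite -(leq_exp2r _ _ j_gt0) expnMn -!expnM.
  by apply: leq_trans le_i _; rewrite leq_mul2r le_h orbT.
have P0 : P 0 by exists j1, h1; split; rewrite ?mul0n ?expn0 ?muln1.
have PnMT : ~ P (M * T).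
  move/P_le; apply/negP; rewrite -ltnNge -(ltn_pmul2l M_gt0).
  apply: leq_trans (succ_expn_ge M (M * T)).
  by rewrite mulnA ltn_mul2r expn_gt0 M_gt0 -[X in X < _]add0n ltn_add2r M_gt0.
have [i [Pi nPi]] : exists i, P i /\ ~ P i.+1.
  apply: NNPP => no_i; apply: PnMT; elim: (M * T) => // i Pi.
  by apply: NNPP => nPi; apply: no_i; exists i.
have le_i := P_le i Pi; case: Pi => j0 [h0 [j0_gt0 good0 le0]].
exists i, j0, h0; split=> // j h j_gt0 good_jh; rewrite ltnNge; apply/negP => le_h.
by apply: nPi; exists j, h.
Qed.

(** Take [z] close to [n / u], adjusted so that [j0] divides the rest. *)
Lemma split_length u j0 K n : 0 < u -> 0 < j0 -> u * (K + j0 + 3) + 4 * u * j0.+1 <= n ->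
  exists k z, [/\ k.+1 * j0 + z = n, u * z <= n, n <= 4 * u * z & K < z].
Proof.
move=> u_gt0 j0_gt0 le_n; set z0 := n %/ u; set k := (n - z0) %/ j0.
have z0_le : u * z0 <= n by rewrite mulnC leq_divM.
have z0_ge : n < u * z0.+1 by rewrite mulnC ltn_ceil.
have k_le : k * j0 <= n - z0 by apply: leq_divM.
have k_ge : n - z0 < k.+1 * j0 by apply: ltn_ceil.
have z0_big : K + j0 + 3 <= z0 by rewrite leq_divRL // mulnC; lia.
clearbody k; clearbody z0; rewrite mulSn in k_ge.
have le_z0n : z0 <= n by apply: leq_trans z0_le; rewrite leq_pmull.
exists k, (n - (j0 + k * j0)); rewrite mulSn; split; try lia.
  by apply: leq_trans z0_le; rewrite leq_mul2l; apply/orP; right; lia.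
apply: (@leq_trans (4 * u * (z0 - j0))); last by rewrite leq_mul2l; apply/orP; right; lia.
have -> : 4 * u * (z0 - j0) = 4 * (u * z0) - 4 * (u * j0) by rewrite mulnBr !mulnA.
rewrite mulnS in z0_ge; rewrite !mulnDr mulnS in le_n.
by lia.
Qed.

(** With [q] for [M.+1 / M] and [n] for the total length, [h] over [h0 ^ k.+1] is at most
    [q ^ (i * z + n)]. Here [q ^ i <= T], and [q ^ n <= 4 ^ z] because [n <= M * z]. *)
Lemma rate_gap M T i j0 k z h h0 : 0 < M -> k.+1 * j0 + z <= M * z ->
    M.+1 ^ (i * j0) <= h0 * M ^ (i * j0) -> M.+1 ^ i <= T * M ^ i ->
    h * M ^ (i.+1 * (k.+1 * j0 + z)) < M.+1 ^ (i.+1 * (k.+1 * j0 + z)) ->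
  h <= h0 ^ k.+1 * (T ^ z * 4 ^ z).
Proof.
move=> M_gt0; set n := k.+1 * j0 + z => n_le le0 le_rate lt_h.
have pos : 0 < M ^ (i.+1 * n) by rewrite expn_gt0 M_gt0.
rewrite -(leq_pmul2r pos); apply: leq_trans (ltnW lt_h) _.
have e x : x ^ (i.+1 * n) = (x ^ (i * j0)) ^ k.+1 * (x ^ i) ^ z * x ^ n.
  by rewrite -!expnM -!expnD; congr (_ ^ _); rewrite /n; lia.
have exp_le x y m : x <= y -> x ^ m <= y ^ m by case: m => // m; rewrite leq_exp2r.
have le3 : M.+1 ^ n <= 4 ^ z * M ^ n.
  have pos' : 0 < M ^ (M * z - n) by rewrite expn_gt0 M_gt0.
  rewrite -(leq_pmul2r pos') -[X in _ <= X]mulnA -expnD subnKC //.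
  apply: (@leq_trans (M.+1 ^ (M * z))); last first.
    by rewrite !expnM -expnMn; apply/exp_le/succ_expn_le4.
  by rewrite -{2}(subnKC n_le) expnD leq_mul2l exp_le ?orbT.
rewrite !e; apply: leq_trans (leq_mul (leq_mul (exp_le _ _ k.+1 le0) (exp_le _ _ z le_rate)) le3) _.
rewrite !expnMn; apply: eq_leq.
by move: (h0 ^ _) ((M ^ _) ^ k.+1) (T ^ z) ((M ^ i) ^ z) (4 ^ z) (M ^ n) => *; lia.
Qed.

(* If the full set is one of the levels, the remaining levels are too few to contain a copy,
   so every copy has an element equal to the full set.  Such placements have a maximal
   exponential rate, and leaving a small positive proportion of the points outside the top
   element of repeated near-optimal placements gains an exponential factor. *)
Lemma avoid_top (d : Order.disp_t) (Q : finPOrderType d) : exists N, forall n s,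
  N <= n -> size s <= height Q -> exists s', [/\ size s' <= height Q, n \notin s' &
    copies Q (levels n s) <= copies Q (levels n s')].
Proof.
pose good j h := exists sigma : Q -> nat, top_profile j sigma /\ h = #|placements j sigma|.
have [T eT] : exists T, T = 2 ^ #|Q| by exists (2 ^ #|Q|).
have T_gt0 : 0 < T by rewrite eT expn_gt0.
(* The gain [u ^ z] from choosing the omitted points must beat [T ^ z * 4 ^ z] from [rate_gap] and
   [2 ^ z] for the constant [K]. With [M = 4 * u], the bound of [split_length] gives
   [n <= M * z]. *)
have [u eu] : exists u, u = 8 * T by exists (8 * T).
have u_gt0 : 0 < u by rewrite eu muln_gt0.
have [M eM] : exists M, M = 4 * u by exists (4 * u).
have M_gt0 : 0 < M by rewrite eM muln_gt0.
have le_T j h : good j h -> h <= T ^ j by case=> sigma [_ ->]; rewrite eT; apply: card_placements_le.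
have use_top n s : size s <= height Q -> n \in s -> 0 < copies Q (levels n s) ->
    exists h, [/\ good n h, 0 < h & copies Q (levels n s) <= height Q ^ #|Q| * h].
  move=> le_s ns c_gt0; have [sigma top le_c] := copies_top_profile le_s ns c_gt0.
  exists #|placements n sigma|; split=> //; first by exists sigma.
  by rewrite lt0n; apply: contraTneq (leq_trans c_gt0 le_c) => ->; rewrite muln0.
case: (classic (exists j h, [/\ 0 < j, good j h & 0 < h])); last first.
  move=> no_good; exists 1 => n s n_gt0 le_s.
  have [ns|nns] := boolP (n \in s); last by exists s.
  exists [::]; split=> //; have [->//|c_gt0] := posnP (copies Q (levels n s)).
  have [h [good_h h_gt0 _]] := use_top n s le_s ns c_gt0.
  by case: no_good; exists n, h.
case=> j1 [h1 [j1_gt0 good1 h1_gt0]].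
have [i [j0 [h0 [j0_gt0 [sigma [[[x0 top0] le_sigma] h0E]] le0 le_rate max_rate]]]] :=
  almost_maximal_rate M_gt0 le_T j1_gt0 good1 h1_gt0.
(* The cost of passing from copies to placements of one profile and back. *)
pose K := height Q ^ #|Q| * #|Q| ^ #|Q|.
have h0_gt0 : 0 < h0.
  rewrite lt0n; apply: contraTneq le0 => ->; rewrite mul0n leqn0 -lt0n.
  by rewrite expn_gt0.
have sigma_le x : sigma x <= j0.
  move: h0_gt0; rewrite h0E => /card_gt0P[phi /placementsP[_ _ <-]]; exact: card_set_ord_le.
exists (u * (K + j0 + 3) + 4 * u * j0.+1) => n s le_n le_s.
have [ns|nns] := boolP (n \in s); last by exists s.
have [c0|c_gt0] := posnP (copies Q (levels n s)); first by exists [::]; rewrite c0.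
have [h [good_h h_gt0 le_c]] := use_top n s le_s ns c_gt0.
have [k [z [en uz_le n_le lt_Kz]]] := split_length u_gt0 j0_gt0 le_n.
have n_gt0 : 0 < n by rewrite -en mulSn -addnA; apply: leq_trans j0_gt0 (leq_addr _ _).
have rate : h <= h0 ^ k.+1 * (T ^ z * 4 ^ z).
  by apply: (rate_gap M_gt0 _ le0 le_rate); rewrite en ?eM //; rewrite -eM; apply: max_rate.
(* The sizes of [k.+1] glued optimal placements; the largest is [k.+1 * j0], which is [n - z]. *)
pose s' := undup [seq k.+1 * sigma x | x <- enum Q].
exists s'; split.
- apply: leq_trans le_sigma.
  rewrite (_ : s' = undup [seq k.+1 * y | y <- [seq sigma x | x <- enum Q]]); last first.
    by rewrite /s' -map_comp.
  rewrite undup_map_inj ?size_map // => x y /eqP; rewrite eqn_mul2l /=; exact/eqP.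
- rewrite mem_undup; apply/mapP => -[x _ ex]; have := sigma_le x.
  rewrite -(leq_pmul2l (ltn0Sn k)) -ex -en -[X in _ <= X]addn0 leq_add2l leqNgt.
  by rewrite (leq_ltn_trans _ lt_Kz).
have in_s' x : k.+1 * sigma x \in s'.
  by rewrite mem_undup; apply: (map_f (fun x => k.+1 * sigma x)); rewrite mem_enum.
have Q_gt0 : 0 < #|Q| ^ #|Q| by rewrite expn_gt0 orbC; case: (#|Q|).
rewrite -(leq_pmul2l Q_gt0); apply: (leq_trans _ (card_placements_copies n in_s')).
have top_k : k.+1 * sigma x0 = k.+1 * j0 by rewrite top0.
have := placements_pad (sigma := fun x => k.+1 * sigma x) z top_k; rewrite en; apply: leq_trans.
apply: (leq_trans _ (leq_mul (leqnn _) (placements_mul j0 sigma k))); rewrite -h0E.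
have -> : 'C(n, k.+1 * j0) = 'C(n, z).
  by rewrite -bin_sub -?en ?leq_addr // addKn.
have exp_bin : u ^ z <= 'C(n, z) by apply: leq_trans (expn_le_bin u z) (leq_bin2l _ _).
apply: (leq_trans _ (leq_mul exp_bin (leqnn _))).
apply: leq_trans (leq_mul (leqnn _) le_c) _.
apply: leq_trans (leq_mul (leqnn _) (leq_mul (leqnn _) rate)) _.
rewrite eu expnMn (_ : 8 ^ z = 2 ^ z * 4 ^ z); last by rewrite -expnMn.
have : K <= 2 ^ z by apply: ltnW (ltn_trans lt_Kz (ltn_expl z (isT : 1 < 2))).
rewrite /K; clear; move: (h0 ^ _) (T ^ z) (4 ^ z) (2 ^ z) (#|Q| ^ _) (_ ^ #|Q|).
move=> a b c e p q le_K.
apply: (@leq_trans (q * p * (a * b * c))); first by apply: eq_leq; lia.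
apply: (@leq_trans (e * (a * b * c))); first by rewrite leq_mul2r le_K orbT.
by apply: eq_leq; lia.
Qed.

(** * Duality and the conclusion *)

Section Duality.
Variables (d : Order.disp_t) (Q : finPOrderType d).

Lemma height_dual : height (Order.dual Q) = height Q.
Proof.
apply: eq_bigl => A; apply: eq_forallb_in => x xA; apply: eq_forallb_in => y yA.
by rewrite /Order.comparable orbC.
Qed.

Lemma is_copy_dual (T : finType) (G : {set {set T}}) :
  is_copy (Order.dual Q) [set ~: A | A in G] = is_copy Q G.
Proof.
have CK (G' : {set {set T}}) : [set ~: A | A in [set ~: A | A in G']] = G'.
  by rewrite -imset_comp -[RHS]imset_id; apply: eq_imset => A /=; rewrite setCK.
apply/is_copyP/is_copyP => -[phi [inj mon eG]]; exists (fun x => ~: phi x); split.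
- by move=> x y /setC_inj/inj.
- by move=> x y le_xy; rewrite setCS mon.
- by rewrite -[LHS]CK eG -imset_comp.
- by move=> x y /setC_inj/inj.
- by move=> x y le_xy; rewrite setCS mon.
- by rewrite eG -imset_comp.
Qed.

Lemma copies_dual (T : finType) (F : {set {set T}}) :
  copies (Order.dual Q) [set ~: A | A in F] = copies Q F.
Proof.
rewrite /copies -[RHS](card_imset _ (imset_inj (@setC_inj T))); apply: eq_card => G.
have CK (G' : {set {set T}}) : [set ~: A | A in [set ~: A | A in G']] = G'.
  by rewrite -imset_comp -[RHS]imset_id; apply: eq_imset => A /=; rewrite setCK.
rewrite inE; apply/andP/imsetP => [[sGF cG]|[G']]; last first.
  by rewrite inE => /andP[sG' cG'] ->; rewrite imsetS ?is_copy_dual.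
exists [set ~: A | A in G]; last by rewrite CK.
by rewrite inE -is_copy_dual CK cG andbT -[F]CK imsetS.
Qed.

(** Entries above [n] are dropped first, since truncated subtraction would turn them into level
    0. *)
Definition reflect_levels n (s : seq nat) := [seq n - k | k <- s & k <= n].

Lemma setC_levels n s : [set ~: A | A in levels n s] = levels n (reflect_levels n s).
Proof.
apply/setP => A; rewrite inE; apply/imsetP/mapP => [[B + ->]|[k]].
  by rewrite inE card_setC_ord => Bs; exists #|B|; rewrite // mem_filter card_set_ord_le.
rewrite mem_filter => /andP[le_kn ks] cA; exists (~: A); last by rewrite setCK.
by rewrite inE card_setC_ord cA subKn.
Qed.

Lemma copies_reflect_levels n s :
  copies (Order.dual Q) (levels n (reflect_levels n s)) = copies Q (levels n s).
Proof. by rewrite -setC_levels copies_dual. Qed.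

Lemma size_reflect_levels n s : size (reflect_levels n s) <= size s.
Proof. by rewrite size_map size_filter count_size. Qed.

(** Complementation reverses inclusion, so this is [avoid_top] for the dual poset. *)
Lemma avoid_bottom : exists N, forall n s,
  N <= n -> size s <= height Q -> exists s', [/\ size s' <= height Q, 0 \notin s' &
    copies Q (levels n s) <= copies Q (levels n s')].
Proof.
have [N avoid] := avoid_top (Order.dual Q); exists N => n s le_n le_s.
have le_rs : size (reflect_levels n s) <= height (Order.dual Q).
  by rewrite height_dual (leq_trans (size_reflect_levels n s)).
have [s' [le_s' ns' le_c]] := avoid n _ le_n le_rs.
exists (reflect_levels n s'); split.
- by rewrite (leq_trans (size_reflect_levels n s')) // -height_dual.
- apply/mapP => -[k]; rewrite mem_filter => /andP[le_kn ks'] /esym/eqP.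
  rewrite subn_eq0 => le_nk; have ek : k = n by apply/eqP; rewrite eqn_leq le_kn.
  by rewrite -ek ks' in ns'.
rewrite -copies_reflect_levels; apply: leq_trans le_c _.
rewrite -[X in _ <= X]copies_reflect_levels; apply: copies_subset.
apply/subsetP => A; rewrite !inE => As'; apply/mapP; exists (n - #|A|).
  rewrite mem_filter leq_subr /=; apply/mapP; exists #|A| => //.
  by rewrite mem_filter card_set_ord_le.
by rewrite subKn // card_set_ord_le.
Qed.

End Duality.

(** Unlike in the almost version no factor may be lost, so no gap is left around [M]. Both parts are
    made large, and the optimal levels are chosen without the top for [Q1] and without the bottom
    for [Q2], which makes the inclusions proper. *)
Lemma strongly_otimes1 (d1 d2 : Order.disp_t)
    (Q1 : finPOrderType d1) (Q2 : finPOrderType d2) :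
  level_conj_strongly (chain_poset (height Q1 + 1)) Q1 ->
  level_conj_strongly (chain_poset (height Q2 + 1)) Q2 ->
  level_conj_strongly (chain_poset (height Q1 + height Q2 + 1 + 1)) (otimes 1 Q1 Q2).
Proof.
case/level_conj_stronglyP => N1 le1 /level_conj_stronglyP[N2 le2].
apply/level_conj_stronglyP; pose K := 2 * 2 ^ #|Q1| + 2 * 2 ^ #|Q2|.
have K_gt0 : 0 < K by rewrite addn_gt0 muln_gt0 expn_gt0.
have t1 := tame_leq (leq_addr _ _ : 2 * 2 ^ #|Q1| <= K) (tame_La (chain_poset (height Q1 + 1)) Q1).
have t2 := tame_leq (leq_addl _ _ : 2 * 2 ^ #|Q2| <= K) (tame_La (chain_poset (height Q2 + 1)) Q2).
have [N1' avoid1] := avoid_top Q1; have [N2' avoid2] := avoid_bottom Q2.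
have [N raise] := raise_binomial (N1 + N2 + N1' + N2') K_gt0 t1 t2.
exists N => n le_n.
rewrite -addnA; apply: leq_trans (La_otimes1_le _ _ _) _; apply/bigmax_leqP => j _.
have [a [c [le_a le_c en /leq_trans]]] := raise n j (n - j) le_n (subnKC (ltnSE (ltn_ord j))).
apply; have [s1 le_s1 e1] := max_levels_attained Q1 a (height Q1).
have [s2 le_s2 e2] := max_levels_attained Q2 c (height Q2).
have [s1' [le_s1' as1' le_c1]] := avoid1 a s1 ltac:(lia) le_s1.
have [s2' [le_s2' s2'0 le_c2]] := avoid2 c s2 ltac:(lia) le_s2.
rewrite -mulnA; apply: (@leq_trans ('C(n, a) *
  (copies Q1 (levels a s1') * copies Q2 (levels c s2')))).
  rewrite leq_mul2l; apply/orP; right; apply: leq_mul.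
    by apply: leq_trans (le1 a ltac:(lia)) _; rewrite e1.
  by apply: leq_trans (le2 c ltac:(lia)) _; rewrite e2.
apply: (@max_levels_otimes1_ge _ _ _ _ n a a c s1' s2' id id) => //.
- by lia.
- by move=> M cM; split=> //; rewrite card_setC_ord; lia.
- by move=> k ks; rewrite leq_eqVlt => /orP[/eqP ek|//]; rewrite -ek ks in as1'.
- move=> k ks; have k_gt0 : 0 < k by rewrite lt0n; apply: contraNneq s2'0 => <-.
  by lia.
Qed.

Theorem theorem1p9 (d1 d2 : Order.disp_t)
    (Q1 : finPOrderType d1) (Q2 : finPOrderType d2)
    (Q1_nonempty : 0 < #|Q1|) (Q2_nonempty : 0 < #|Q2|) :
  (* (a) *)
  (forall r : nat, 2 <= r ->
    (forall n : nat, 1 <= n ->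
      La n (chain_poset (height Q1 + height Q2 + 2)) (otimes r Q1 Q2) <=
      n ^ (2 * r + 2) *
      \max_(j < n.+1) \max_(i < j)
        ('C(n, j) * 'C(j, i) *
         gamma r (full_level (j - i) ((j - i) %/ 2)) *
         La i (chain_poset (height Q1 + 1)) Q1 *
         La (n - j) (chain_poset (height Q2 + 1)) Q2)) /\
    (3 <= r ->
      level_conj_almost (chain_poset (height Q1 + 1)) Q1 ->
      level_conj_almost (chain_poset (height Q2 + 1)) Q2 ->
      level_conj_almost (chain_poset (height (otimes r Q1 Q2) + 1))
        (otimes r Q1 Q2))) /\
  (* (b) *)
  ((forall n : nat, 1 <= n ->
      La n (chain_poset (height Q1 + height Q2 + 2)) (otimes 1 Q1 Q2) <=
      \max_(j < n.+1)
        ('C(n, j) *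
         La j (chain_poset (height Q1 + 1)) Q1 *
         La (n - j) (chain_poset (height Q2 + 1)) Q2)) /\
   (level_conj_strongly (chain_poset (height Q1 + 1)) Q1 ->
    level_conj_strongly (chain_poset (height Q2 + 1)) Q2 ->
    level_conj_strongly (chain_poset (height (otimes 1 Q1 Q2) + 1))
      (otimes 1 Q1 Q2)) /\
   (level_conj_almost (chain_poset (height Q1 + 1)) Q1 ->
    level_conj_almost (chain_poset (height Q2 + 1)) Q2 ->
    level_conj_almost (chain_poset (height (otimes 1 Q1 Q2) + 1))
      (otimes 1 Q1 Q2))).
Proof.
split=> [r r_gt1|].
  rewrite height_otimes ?(ltnW r_gt1) //; split; last exact: almost_otimes.
  by move=> n n_gt0; apply: La_otimes_le.
rewrite height_otimes //; split; first by move=> n _; apply: La_otimes1_le.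
by split; [apply: strongly_otimes1|apply: almost_otimes1].
Qed.
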